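(* Let $\mathfrak A$ be a divisor of $\Delta$. Then the $\tilde J_{\tilde{\underline{\mathfrak o}}}$-multiple ideal $[\tilde{\mathfrak A}]_{\tilde{\underline{\mathfrak o}}}$ of $\tilde{\mathfrak A}$ in $\tilde\Delta$ is $$[\tilde{\mathfrak A}]_{\tilde{\underline{\mathfrak o}}}=[\mathfrak A]_{\underline{\mathfrak o}}\,\tilde J_{\tilde{\underline{\mathfrak o}}}.$$ Here $\tilde K'$ is a finite extension of $K'$, $\tilde\Delta$ is the double field of $K$ and $\tilde K'$, $\tilde{\mathfrak A}$ is the extension of $\mathfrak A$ in $\tilde\Delta$, $\underline{\mathfrak o}=(\mathfrak o,\mathfrak o')$ is a pair of prime divisors of $K,K'$, $\tilde{\mathfrak o}'$ is a prime divisor of $\tilde K'$ lying above $\mathfrak o'$, and $\tilde{\underline{\mathfrak o}}=(\mathfrak o,\tilde{\mathfrak o}')$.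
   Context: Setting. $k$ is a number field. $K$ and $K'$ are algebraic function fields of one variable over $k$: finite extensions of $k(x)$ and $k(x')$, respectively, with $x,x'$ algebraically independent over $k$. The double field of $K$ and $K'$ is $\Delta=k(x,x';u,u')$ with $f(x,u)=0$ and $f'(x',u')=0$, where $f,f'$ are generating irreducible polynomials of $K=k(x,u)$ and $K'=k(x',u')$ over $k$. The double field $\tilde\Delta$ of $K$ and $\tilde K'$ is defined in the same way and is a finite extension of $\Delta$. Divisors. The prime divisors $\mathfrak m$ of $\Delta$ considered are normalized valuations $w_{\mathfrak m}$ of $\Delta$ that are binary (identically zero on both $K$ and $K'$), $K$-unary (identically zero on $K'$, not on $K$), or $K'$-unary (identically zero on $K$, not on $K'$). The $K$-unary and $K'$-unary prime divisors are identified with the prime divisors of $K$ and $K'$, respectively. A divisor of $\Delta$ is a formal sum $\mathfrak A=\sum w_{\mathfrak m}(\mathfrak A)\,\mathfrak m$ over these prime divisors with integer coefficients, almost all zero. The same terminology is used for $\tilde\Delta$ with $K,\tilde K'$. Multiple ideals. $[\mathfrak A]_{\underline{\mathfrak o}}$ is the set of all $a\in\Delta$ such that $w_{\mathfrak m}(a)\ge w_{\mathfrak m}(\mathfrak A)$ for all binary prime divisors $\mathfrak m$ of $\Delta$, and $w_{\mathfrak o}(a)\ge w_{\mathfrak o}(\mathfrak A)$, $w_{\mathfrak o'}(a)\ge w_{\mathfrak o'}(\mathfrak A)$. $J_{\underline{\mathfrak o}}$ is the ring of all elements of $\Delta$ integral for all binary prime divisors and for $\mathfrak o,\mathfrak o'$.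 In $\tilde\Delta$, $[\tilde{\mathfrak A}]_{\tilde{\underline{\mathfrak o}}}$ and $\tilde J_{\tilde{\underline{\mathfrak o}}}$ are defined in the same way with respect to $K,\tilde K'$ and the unary pair $(\mathfrak o,\tilde{\mathfrak o}')$; $\tilde J_{\tilde{\underline{\mathfrak o}}}$ is the ring composite $[1_{\mathfrak o},\tilde 1'_{\tilde{\mathfrak o}'}]$ of the rings $1_{\mathfrak o}$ of $\mathfrak o$-integral elements of $K$ and $\tilde 1'_{\tilde{\mathfrak o}'}$ of $\tilde{\mathfrak o}'$-integral elements of $\tilde K'$. The product $[\mathfrak A]_{\underline{\mathfrak o}}\tilde J_{\tilde{\underline{\mathfrak o}}}$ is the $\tilde J_{\tilde{\underline{\mathfrak o}}}$-ideal generated by $[\mathfrak A]_{\underline{\mathfrak o}}$. *)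

(* Defs.v *)
From HB Require Import structures.
From mathcomp Require Import all_boot all_order all_algebra all_field.
From mathcomp Require Import fraction polyXY.
From mathcomp Require Import boolp classical_sets cardinality.

Set Implicit Arguments.
Unset Strict Implicit.
Unset Printing Implicit Defensive.

Import Order.TTheory GRing.Theory Num.Theory.
Local Open Scope ring_scope.
Local Open Scope classical_set_scope.

(* An algebraic function field of one variable over k is a finite extension
   of the rational function field k(x). *)
Section FunctionField.
Variables (k : fieldType) (K : fieldExtType {fraction {poly k}}).

Definition ff_var : K := in_alg K (tofrac ('X : {poly k})).

Definition ff_const : {rmorphism k -> K} :=
  in_alg K \o @tofrac {poly k} \o polyC.

End FunctionField.

Arguments ff_var {k} K.
Arguments ff_const {k} K.

Section DoubleField.
Variables (k K K' D : fieldType).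
Variables (c : {rmorphism k -> K}) (x : K) (c' : {rmorphism k -> K'}) (x' : K').
Variables (i : {rmorphism K -> D}) (i' : {rmorphism K' -> D}).

Definition alg_independent (e : {rmorphism k -> D}) (a b : D) : Prop :=
  forall p : {poly {poly k}}, (map_poly (map_poly e) p).[a, b] = 0 -> p = 0.

(* When K = k(x,u) and K' = k(x',u'), the field k(x,x';u,u') is the compositum
   of K and K': a field generated by copies of K and K' that share k and in
   which x, x' are algebraically independent over k. *)
Definition is_double_field : Prop :=
  [/\ forall a : k, i (c a) = i' (c' a),
      alg_independent (i \o c) (i x) (i' x') &
      forall S : {pred D}, divring_closed S ->
        (forall a, i a \in S) -> (forall b, i' b \in S) -> forall d, d \in S].

End DoubleField.

(* Normalized discrete valuations w : F -> Z u {oo}. The value oo is taken at 0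
   only; it is encoded by the dummy value w 0 = 0, fixed once and for all so that
   two records with the same valuation are equal. Bounds on values must
   therefore go through val_ge, under which 0 satisfies every bound. *)
Record valuation (F : fieldType) := Valuation {
  val_fun :> F -> int;
  val0 : val_fun 0 = 0;
  valM : forall a b, a != 0 -> b != 0 -> val_fun (a * b) = val_fun a + val_fun b;
  valD : forall a b, a != 0 -> b != 0 -> a + b != 0 ->
    Num.min (val_fun a) (val_fun b) <= val_fun (a + b);
  val_normalized : exists2 a, a != 0 & val_fun a = 1 }.

Definition val_ge (F : fieldType) (w : valuation F) (a : F) (n : int) : Prop :=
  a = 0 \/ n <= w a.

(* w is identically zero on the (nonzero elements of the) image of i *)
Definition trivial_on (E F : fieldType) (i : E -> F) (w : valuation F) : Prop :=
  forall a : E, w (i a) = 0.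

(* w lies above v with ramification index e *)
Definition lies_above (E F : fieldType) (j : E -> F)
    (v : valuation E) (w : valuation F) (e : nat) : Prop :=
  (0 < e)%N /\ forall a : E, w (j a) = e%:Z * v a.

Section Divisors.
Variables (K K' D : fieldType).
Variables (i : {rmorphism K -> D}) (i' : {rmorphism K' -> D}).

Definition binary (m : valuation D) : Prop := trivial_on i m /\ trivial_on i' m.
Definition unary (m : valuation D) : Prop := trivial_on i' m /\ ~ trivial_on i m.
Definition unary' (m : valuation D) : Prop := trivial_on i m /\ ~ trivial_on i' m.

Definition prime_divisor (m : valuation D) : Prop :=
  [\/ binary m, unary m | unary' m].

Record divisor := Divisor {
  coef :> valuation D -> int;
  divisor_supp : forall m, coef m != 0 -> prime_divisor m;
  divisor_finite : finite_set [set m | coef m != 0] }.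

(* The identification of prime divisors o of K with K-unary prime divisors m
   of D: o is the restriction of m to K. When k is algebraically closed in K and
   K' there is exactly one such m; otherwise all of them are retained, so that
   the ring of integral elements is still the composite of those of o and o'. *)
Definition unary_at (o : valuation K) (m : valuation D) : Prop :=
  unary m /\ forall a, m (i a) = o a.
Definition unary_at' (o' : valuation K') (m : valuation D) : Prop :=
  unary' m /\ forall b, m (i' b) = o' b.

Definition multiple_ideal (o : valuation K) (o' : valuation K')
    (A : valuation D -> int) : set D :=
  [set a | forall m, [\/ binary m, unary_at o m | unary_at' o' m] ->
             val_ge m a (A m)].

Definition integral_ring (o : valuation K) (o' : valuation K') : set D :=
  multiple_ideal o o' (fun=> 0).

End Divisors.

(* The extension of a divisor A of D to Dt: each prime divisor m of D becomes
   the sum of e(mt/m) mt over the prime divisors mt of Dt above m. *)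
Definition divisor_extension (D Dt : fieldType) (j : D -> Dt)
    (A : valuation D -> int) (At : valuation Dt -> int) : Prop :=
  forall (m : valuation D) (mt : valuation Dt) (e : nat),
    lies_above j m mt e -> At mt = e%:Z * A m.

(* The J-submodule generated by the image of I. *)
Definition generated_ideal (D Dt : fieldType) (j : D -> Dt)
    (I : set D) (J : set Dt) : set Dt :=
  [set b | exists (n : nat) (a : 'I_n -> D) (r : 'I_n -> Dt),
     (forall l, I (a l)) /\ (forall l, J (r l)) /\
     b = \sum_(l < n) j (a l) * r l].

(* Main.v *)
Require Import Defs.
From HB Require Import structures.
From mathcomp Require Import all_boot all_order all_algebra all_field.
From mathcomp Require Import fraction polyXY.
From mathcomp Require Import boolp classical_sets cardinality.
From mathcomp Require Import fingroup zify ring.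

(** Why the theorem holds. Write Dt for the larger double field, j for the
    inclusion of D in Dt, and It and I for the two multiple ideals, of the
    extended divisor and of A.

    That I Jt is contained in It only says that the valuations of Dt that define
    It restrict to multiples of valuations of D that define I, the multiple
    being the ramification index that enters the extension of the divisor.

    For the converse, an element b of It is written down explicitly. Let x_l and
    y_l be bases of Kt' over K' that are dual for the trace. Their tensor
    sum_l y_l (x) x_l is, up to a rational constant, the separability idempotent
    of Kt' / K'; since Dt is generated by D and Kt', it is a quotient of
    D (x) Kt', and the idempotent gives, for every b in Dt,
       b = const * sum_l Tr(b y_l) x_l,
    with Tr the trace of Dt / D (lemma reconstruction). So it is enough that the
    coefficients Tr(b y_l) lie in I and the x_l in Jt. At binary and at K-unary
    places the elements of Kt' are units and there is nothing to do. At the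
    places over o' two obstacles appear.

    First, Kt' may have other primes over o', at which b is not controlled.
    One replaces b by u b and x_l by x_l / u, where u is close to 1 at the chosen
    prime and highly divisible at the other ones (lemma above_idempotent).

    Second, the chosen prime may ramify over o', with index e. Then dual bases
    can be chosen with x_l integral and y_l with a pole of order at most e - 1
    there (lemma dual_basis). These poles are harmless: in terms of a place m of
    D they have order less than 1, and m takes integral values on traces
    (lemma trace_vge).

    Both directions compare places of D and Dt with the primes of K, K' and Kt'
    below them, and need these places to be unramified. This holds because the
    composite of a function field, in characteristic zero, with a field on which
    the valuation is trivial is unramified over the function field (lemma
    composite_unramified).

    Valuations of D are extended to finite extensions by maximality, as in
    Chevalley's extension theorem (lemma extend_valuation), and traces are sums
    over a Galois closure (lemmas galois_closure and galois_data_exist). *)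

Set Implicit Arguments.
Unset Strict Implicit.
Unset Printing Implicit Defensive.

Import Order.TTheory GRing.Theory Num.Theory.
Local Open Scope ring_scope.
Local Open Scope classical_set_scope.

(** * Unnormalized discrete valuations *)

(** Restricting a valuation to a subfield, or transporting it by an embedding,
    yields a multiple of a normalized valuation, possibly the zero map. The
    normalization is dropped so that these operations stay inside one notion. *)
Definition preval (F : fieldType) (w : F -> int) : Prop :=
  [/\ w 0 = 0,
      forall a b, a != 0 -> b != 0 -> w (a * b) = w a + w b &
      forall a b, a != 0 -> b != 0 -> a + b != 0 ->
        Num.min (w a) (w b) <= w (a + b)].

(** The bound val_ge for unnormalized maps: at 0 the value is a dummy, and the
    bound holds. With this convention the elements satisfying a bound are closed
    under sums. *)
Definition vge (F : fieldType) (w : F -> int) (a : F) (n : int) : Prop :=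
  a = 0 \/ n <= w a.

Lemma valuation_preval (F : fieldType) (v : valuation F) : preval v.
Proof. by split; [apply: Defs.val0|apply: Defs.valM|apply: Defs.valD]. Qed.

Lemma preval_comp (E F : fieldType) (f : {rmorphism E -> F}) (w : F -> int) :
  preval w -> preval (w \o f).
Proof.
case=> w0 wM wD; split=> [|a b a0 b0|a b a0 b0 ab0] /=.
- by rewrite rmorph0.
- by rewrite rmorphM wM // fmorph_eq0.
- by rewrite rmorphD wD // -?rmorphD fmorph_eq0.
Qed.

Section Preval.
Variables (F : fieldType) (w : F -> int).
Hypothesis pw : preval w.

Lemma pval0 : w 0 = 0. Proof. by case: pw. Qed.

Lemma pvalM a b : a != 0 -> b != 0 -> w (a * b) = w a + w b.
Proof. by case: pw => _ + _; apply. Qed.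

Lemma pval1 : w 1 = 0.
Proof.
have n1 : (1 : F) != 0 by exact: oner_neq0.
by have := pvalM n1 n1; rewrite mulr1; lia.
Qed.

Lemma pvalV a : w a^-1 = - w a.
Proof.
have [->|a0] := eqVneq a 0; first by rewrite invr0 pval0 oppr0.
by have := pvalM a0 (invr_neq0 a0); rewrite mulfV // pval1; lia.
Qed.

Lemma pvalX a n : w (a ^+ n) = n%:Z * w a.
Proof.
have [->|a0] := eqVneq a 0.
  by case: n => [|n]; rewrite ?expr0 ?pval1 ?mul0r // expr0n pval0 mulr0.
elim: n => [|n IH]; first by rewrite expr0 pval1 mul0r.
by rewrite exprS pvalM ?expf_neq0 // IH; lia.
Qed.

Lemma pvalN a : w (- a) = w a.
Proof.
have [->|a0] := eqVneq a 0; first by rewrite oppr0.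
have N1: (-1 : F) != 0 by rewrite oppr_eq0 oner_eq0.
have := pvalM N1 N1; rewrite mulrNN mulr1 pval1 => w1.
by rewrite -mulN1r pvalM //; lia.
Qed.

Lemma pvalMz a n : w (a ^ n) = n * w a.
Proof. by case: n => n; rewrite ?pvalX // NegzE -exprnN pvalV pvalX; lia. Qed.

Lemma pvalD a b n : a != 0 -> b != 0 -> a + b != 0 ->
  n <= w a -> n <= w b -> n <= w (a + b).
Proof.
case: pw => _ _ H a0 b0 ab0 na nb; apply: le_trans (H _ _ a0 b0 ab0).
by rewrite le_min na nb.
Qed.

Lemma vge0 n : vge w 0 n. Proof. by left. Qed.

Lemma vge_le a n m : m <= n -> vge w a n -> vge w a m.
Proof. by move=> mn [->|]; [left|right; lia]. Qed.

Lemma vgeN a n : vge w a n -> vge w (- a) n.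
Proof. by case=> [->|?]; [left; rewrite oppr0|right; rewrite pvalN]. Qed.

Lemma vgeD a b n : vge w a n -> vge w b n -> vge w (a + b) n.
Proof.
have [->|a0] := eqVneq a 0; first by rewrite add0r.
have [->|b0] := eqVneq b 0; first by rewrite addr0.
case=> [/eqP|an]; first by rewrite (negPf a0).
case=> [/eqP|bn]; first by rewrite (negPf b0).
have [->|ab0] := eqVneq (a + b) 0; first by left.
by right; apply: pvalD.
Qed.

Lemma vgeB a b n : vge w a n -> vge w b n -> vge w (a - b) n.
Proof. by move=> an /vgeN; apply: vgeD. Qed.

Lemma vgeM a b n m : vge w a n -> vge w b m -> vge w (a * b) (n + m).
Proof.
have [->|a0] := eqVneq a 0; first by left; rewrite mul0r.
have [->|b0] := eqVneq b 0; first by left; rewrite mulr0.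
case=> [/eqP|an]; first by rewrite (negPf a0).
case=> [/eqP|bn]; first by rewrite (negPf b0).
by right; rewrite pvalM //; lia.
Qed.

Lemma vgeM0 a b : vge w a 0 -> vge w b 0 -> vge w (a * b) 0.
Proof. by move=> a0 b0; have := vgeM a0 b0; rewrite addr0. Qed.

Lemma vge1 : vge w 1 0. Proof. by right; rewrite pval1. Qed.

Lemma vgeX a n : vge w a 0 -> vge w (a ^+ n) 0.
Proof.
by move=> a0; elim: n => [|n IH]; rewrite ?expr0 ?exprS; [apply: vge1|apply: vgeM0].
Qed.

Lemma vge_sum (I : Type) (r : seq I) (P : pred I) (f : I -> F) n :
  (forall i, P i -> vge w (f i) n) -> vge w (\sum_(i <- r | P i) f i) n.
Proof.
move=> H; apply: (big_ind (fun a => vge w a n)) => //; first exact: vge0.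
by move=> a b; apply: vgeD.
Qed.

Lemma vge_prod (I : Type) (r : seq I) (P : pred I) (f : I -> F) :
  (forall i, P i -> vge w (f i) 0) -> vge w (\prod_(i <- r | P i) f i) 0.
Proof.
move=> H; apply: (big_ind (fun a => vge w a 0)) => //; first exact: vge1.
by move=> a b; apply: vgeM0.
Qed.

Lemma vge_horner (p : {poly F}) a :
  (forall i, vge w p`_i 0) -> vge w a 0 -> vge w p.[a] 0.
Proof.
by move=> p0 a0; rewrite horner_coef; apply: vge_sum => i _; apply: vgeM0 => //;
  apply: vgeX.
Qed.

(** Otherwise a = (a + b) - b would have a value larger than its own. *)
Lemma pvalD_eq a b : a != 0 -> vge w b (w a + 1) ->
  a + b != 0 /\ w (a + b) = w a.
Proof.
move=> a0 b1.
have [e|ab0] := eqVneq (a + b) 0.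
  have eb: b = - a by apply/eqP; rewrite -addr_eq0 addrC e.
  by case: b1 => [b0|]; [move: a0; rewrite -oppr_eq0 -eb b0 eqxx|rewrite eb pvalN; lia].
split=> //; case: b1 => [->|b1]; first by rewrite addr0.
have [b0|b0] := eqVneq b 0; first by rewrite b0 addr0.
apply/eqP; rewrite eq_le; apply/andP; split; last first.
  by apply: pvalD => //; lia.
rewrite leNgt; apply/negP => h.
have: vge w (a + b - b) (w a + 1).
  by apply: vgeB; right; lia.
by rewrite addrK => -[/eqP|]; [rewrite (negPf a0)|lia].
Qed.

Lemma unit_near1 u : vge w (u - 1) 1 -> u != 0 /\ w u = 0.
Proof.
move=> h; have := @pvalD_eq 1 (u - 1) (oner_neq0 F).
by rewrite pval1 add0r [1 + _]addrC subrK; apply.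
Qed.

(** With a pole of larger order, the leading term would be the only term of
    least value in p(a), which could not vanish. *)
Lemma vge_root (p : {poly F}) a : p != 0 -> (forall i, vge w p`_i 0) ->
  root p a -> vge w a (- w (lead_coef p)).
Proof.
move=> p0 pi pa.
have [->|a0] := eqVneq a 0; first by left.
have [lt|] := ltP (w a) (- w (lead_coef p)); last by right.
have lc0: lead_coef p != 0 by rewrite lead_coef_eq0.
have [] := pi (size p).-1; first by rewrite -lead_coefE; move/eqP; rewrite (negPf lc0).
rewrite -lead_coefE => lcge.
have sz: size p = (size p).-1.+1 by rewrite prednK // size_poly_gt0.
move: pa; rewrite rootE horner_coef sz big_ord_recr /= -lead_coefE addrC.
set n := (size p).-1; set s := \sum_(i < n) _.
have an0: a ^+ n != 0 by rewrite expf_neq0.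
have t0: lead_coef p * a ^+ n != 0 by rewrite mulf_neq0.
have [|/negPf-> //] := @pvalD_eq (lead_coef p * a ^+ n) s t0.
rewrite pvalM // pvalX; apply: vge_sum => i _.
apply: (@vge_le _ (0 + i%:Z * w a)); last first.
  by apply: vgeM => //; right; rewrite pvalX.
by have := ltn_ord i; nia.
Qed.

(** A monic equation over trivially valued constants allows no pole; apply this
    to a and to 1 / a. *)
Lemma pval_algebraic0 (E : fieldType) (e : {rmorphism E -> F}) a :
  (forall c, w (e c) = 0) -> algebraicOver e a -> w a = 0.
Proof.
move=> tr.
have key b : algebraicOver e b -> 0 <= w b.
  case=> p p0 pb.
  have [||//|->|] := @vge_root (map_poly e p) b; rewrite ?map_poly_eq0 ?pval0 //.
    by move=> i; rewrite coef_map; right; rewrite tr.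
  by rewrite lead_coef_map tr oppr0.
move=> alg; have := key _ alg; have := key _ (algebraic_inv alg).
by rewrite pvalV; lia.
Qed.

End Preval.

Lemma algebraicOver_ext (F : fieldType) (L : fieldExtType F) (a : L) :
  algebraicOver (in_alg L) a.
Proof.
have /polyOver1P[p Dp] := minPolyOver 1%AS a.
exists p; last by rewrite -Dp root_minPoly.
by rewrite -(map_poly_eq0 (in_alg L)) -Dp monic_neq0 ?monic_minPoly.
Qed.

Lemma valuation_eq (F : fieldType) (v v' : valuation F) :
  (forall a, v a = v' a) -> v = v'.
Proof.
case: v v' => [f a b c d] [f' a' b' c' d'] /= /funext H; subst f'.
by f_equal; apply: Prop_irrelevance.
Qed.

(** The least positive value generates the value group, by division with
    remainder. *)
Lemma preval_normalize (F : fieldType) (w : F -> int) : preval w ->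
  (exists a, w a != 0) ->
  exists (r : nat) (v : valuation F), (0 < r)%N /\ forall a, w a = r%:Z * v a.
Proof.
move=> pw [a wa0].
pose P n := `[< exists b, w b = n.+1%:Z >].
have exP: exists n, P n.
  exists `|w a|%N.-1; apply/asboolP.
  have [ge|lt] := leP 0 (w a).
    by exists a; lia.
  by exists a^-1; rewrite pvalV //; lia.
case: (ex_minnP exP) => n /asboolP[p wp] nmin.
have p0 : p != 0 by apply: contra_eq_neq wp => ->; rewrite pval0.
have dvd b : w b = n.+1%:Z * (w b %/ n.+1%:Z)%Z.
  have [->|b0] := eqVneq b 0; first by rewrite pval0 // div0z mulr0.
  set q := (_ %/ _)%Z.
  have E := divz_eq (w b) n.+1%:Z; rewrite -/q in E.
  have rlt : (w b %% n.+1%:Z)%Z < n.+1%:Z by rewrite ltz_pmod.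
  have rge : 0 <= (w b %% n.+1%:Z)%Z by rewrite modz_ge0.
  have wr : w (b * p ^ (- q)) = (w b %% n.+1%:Z)%Z.
    by rewrite pvalM ?expfz_neq0 // pvalMz // wp; lia.
  have [z|nz] := eqVneq (w b %% n.+1%:Z)%Z 0; first by lia.
  have /nmin : P `|(w b %% n.+1%:Z)%Z|%N.-1.
    by apply/asboolP; exists (b * p ^ (- q)); rewrite wr; lia.
  lia.
have n0 : n.+1%:Z != 0 by [].
have vE b m : w b = n.+1%:Z * m -> (w b %/ n.+1%:Z)%Z = m.
  by move=> ->; rewrite mulrC mulzK.
have [w0 wM wD] := pw.
unshelve eexists n.+1, (@Valuation F (fun b => (w b %/ n.+1%:Z)%Z) _ _ _ _) => //=.
- by rewrite w0 div0z.
- by move=> b c b0 c0; apply: vE; rewrite wM // mulrDr -!dvd.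
- move=> b c b0 c0 bc0; rewrite -(ler_pM2l (_ : 0 < n.+1%:Z)) // -dvd.
  by apply: (pvalD pw) => //; rewrite [leRHS]dvd ler_pM2l // ge_min lexx ?orbT.
- by exists p => //; apply: vE; rewrite wp mulr1.
Qed.

(** * Extending a discrete valuation to a finite extension *)

Definition subring (L : fieldType) (R : set L) : Prop :=
  [/\ R 1, forall a b, R a -> R b -> R (a - b)
    & forall a b, R a -> R b -> R (a * b)].

Section Subring.
Variables (L : fieldType) (R : set L).
Hypothesis sR : subring R.

Lemma sr1 : R 1. Proof. by case: sR. Qed.
Lemma srB a b : R a -> R b -> R (a - b). Proof. by case: sR => _ + _; apply. Qed.
Lemma srM a b : R a -> R b -> R (a * b). Proof. by case: sR => _ _; apply. Qed.
Lemma sr0 : R 0. Proof. by rewrite -(subrr 1); apply: srB; apply: sr1. Qed.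
Lemma srN a : R a -> R (- a).
Proof. by move=> Ra; rewrite -sub0r; apply: srB => //; apply: sr0. Qed.
Lemma srD a b : R a -> R b -> R (a + b).
Proof. by move=> Ra Rb; rewrite -[b]opprK; apply: srB => //; apply: srN. Qed.
Lemma srX a n : R a -> R (a ^+ n).
Proof.
by move=> Ra; elim: n => [|n IH]; rewrite ?expr0 ?exprS; [apply: sr1|apply: srM].
Qed.
Lemma sr_sum (I : Type) (r : seq I) (P : pred I) (f : I -> L) :
  (forall i, P i -> R (f i)) -> R (\sum_(i <- r | P i) f i).
Proof.
move=> H; apply: (big_ind R) => //; first exact: sr0.
by move=> a b; apply: srD.
Qed.

Definition adjoin_set (c : L) : set L :=
  [set z | exists p : {poly L}, (forall i, R p`_i) /\ z = p.[c]].

Lemma adjoin_subring c : subring (adjoin_set c).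
Proof.
split.
- exists 1; split; last by rewrite hornerC.
  by move=> i; rewrite coefC; case: ifP => _; [apply: sr1|apply: sr0].
- move=> _ _ [p [Rp ->]] [q [Rq ->]]; exists (p - q); rewrite hornerD hornerN.
  by split=> // i; rewrite coefB; apply: srB.
- move=> _ _ [p [Rp ->]] [q [Rq ->]]; exists (p * q); rewrite hornerM.
  by split=> // i; rewrite coefM; apply: sr_sum => j _; apply: srM.
Qed.

Lemma adjoin_sub c : R `<=` adjoin_set c.
Proof.
move=> a Ra; exists a%:P; rewrite hornerC; split=> // i.
by rewrite coefC; case: ifP => _ //; apply: sr0.
Qed.

Lemma adjoin_gen c : adjoin_set c c.
Proof.
exists 'X; rewrite hornerX; split=> // i.
by rewrite coefX; case: eqP => _; [apply: sr1|apply: sr0].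
Qed.

End Subring.

(** Zorn's lemma; the empty set is admitted as the union of the empty chain. *)
Lemma max_subring (L : fieldType) (R0 : set L) (y : L) :
  subring R0 -> ~ R0 y ->
  exists R, [/\ subring R, R0 `<=` R, ~ R y &
    forall R', subring R' -> R `<=` R' -> ~ R' y -> R' `<=` R].
Proof.
move=> sR0 R0y.
pose P (X : set L) := X = set0 \/ [/\ subring X, R0 `<=` X & ~ X y].
have [|A [PA Amax]] := @Zorn_bigcup L P.
  move=> C CP tot; have [[X [CX X0]]|noX] := pselect (exists X, C X /\ X !=set0).
    right; have good Y : C Y -> Y !=set0 -> [/\ subring Y, R0 `<=` Y & ~ Y y].
      by move=> CY [z Yz]; case: (CP _ CY) => // Y0; rewrite Y0 in Yz.
    have [sX R0X _] := good _ CX X0.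
    have two a b : (\bigcup_(Z in C) Z) a -> (\bigcup_(Z in C) Z) b ->
        exists Y, [/\ C Y, Y a & Y b].
      move=> [Y CY Ya] [Z CZ Zb].
      by case: (tot _ _ CY CZ) => H; [exists Z|exists Y]; split=> //; apply: H.
    split.
    - split.
      + by exists X => //; apply: sr1.
      + move=> a b /two H/H [Y [CY Ya Yb]]; exists Y => //.
        by have [] := good _ CY (ex_intro _ a Ya) => sY _ _; apply: srB.
      + move=> a b /two H/H [Y [CY Ya Yb]]; exists Y => //.
        by have [] := good _ CY (ex_intro _ a Ya) => sY _ _; apply: srM.
    - by move=> a R0a; exists X => //; apply: R0X.
    - by move=> [Y CY Yy]; have [] := good _ CY (ex_intro _ y Yy).
  left; apply/seteqP; split=> // a [X CX Xa].
  by case: noX; exists X; split=> //; exists a.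
have gA : [/\ subring A, R0 `<=` A & ~ A y].
  case: PA => // A0; case: (Amax R0); last by right; split.
  rewrite A0; split; first by move=> ?.
  by move=> H; have := H 1 (sr1 sR0).
exists A; case: gA => sA R0A Ay; split=> // R' sR' AR' R'y.
apply: contrapT => nR'; apply: (Amax R'); first by split.
by right; split=> // a /R0A /AR'.
Qed.

(** If neither a nor 1 / a lay in R, then by maximality y would be a polynomial
    in a and one in 1 / a with coefficients in R. Divided by y, these read
    1 = P(a) = Q(1 / a) with all coefficients multiples of 1 / y, a non-unit.
    Since 1 - Q(0) is invertible, the shorter of the two relations rewrites the
    leading term of the longer one, so the degrees descend. *)
Lemma max_subring_valuation (L : fieldType) (R : set L) (y : L) :
  subring R -> ~ R y -> R y^-1 ->
  (forall R', subring R' -> R `<=` R' -> ~ R' y -> R' `<=` R) ->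
  forall a, R a \/ R a^-1.
Proof.
move=> sR Ry Rpi Rmax; set pi := y^-1 in Rpi.
have y0 : y != 0 by apply: contra_not_neq Ry => ->; apply: sr0.
have yin c : ~ R c -> exists p : {poly L}, (forall i, R p`_i) /\ y = p.[c].
  move=> Rc; apply: contrapT => ny; apply: Rc.
  by apply: (Rmax (adjoin_set R c));
    [apply: adjoin_subring|apply: adjoin_sub| |apply: adjoin_gen].
have loc s : R s -> R (1 - pi * s)^-1.
  (* If the inverse c were not in R, then y = p(c); multiplying by a power of
     1 - s / y clears the powers of c and shows y in R. *)
  move=> Rs; apply: contrapT => /yin [p [Rp]]; set c := _^-1 => yE.
  have c1 : (1 - pi * s) * c = 1.
    rewrite mulfV // subr_eq0; apply: contra_not_neq Ry => h.
    suff -> : y = s by [].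
    by rewrite -[LHS]mulr1 h mulrA mulfV // mul1r.
  have R1 : R (1 - pi * s) by apply: srB => //; [apply: sr1|apply: srM].
  have Rn n : exists s', R s' /\ (1 - pi * s) ^+ n = 1 - pi * s'.
    elim: n => [|n [s' [Rs' E]]].
      by exists 0; rewrite expr0 mulr0 subr0; split=> //; apply: sr0.
    exists (s + s' - pi * s * s'); split; last by rewrite exprS E; ring.
    apply: srB => //; first exact: srD.
    by apply: srM => //; apply: srM.
  have [s' [Rs' E]] := Rn (size p).
  apply: Ry; have -> : y = y * (1 - pi * s') + s'.
    by rewrite mulrBr mulr1 mulrA mulfV // mul1r subrK.
  apply: srD => //; rewrite -E yE horner_coef mulr_suml; apply: sr_sum => // i _.
  have cX n k : (k <= n)%N -> c ^+ k * (1 - pi * s) ^+ n = (1 - pi * s) ^+ (n - k).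
    move=> kn; rewrite -{1}(subnK kn) addnC exprD mulrA -exprMn mulrC.
    by rewrite [c * _]mulrC c1 expr1n mulr1.
  by rewrite -mulrA cX ?(ltnW (ltn_ord i)) //; apply: srM => //; apply: srX.
pose D a n := exists P : {poly L}, [/\ (size P <= n.+1)%N,
  forall i, exists r, R r /\ P`_i = pi * r & P.[a] = 1].
have key N : forall n m a, (n + m <= N)%N -> a != 0 -> D a n -> D a^-1 m -> False.
  elim: N => [|N IH] n m a; last first.
    wlog mn : n m a / (m <= n)%N.
      move=> H nm a0 Dn Dm; have [mn|/ltnW nm'] := leqP m n; first exact: (H n m a).
      by apply: (H m n a^-1) => //; rewrite ?invr_eq0 ?invrK // addnC.
    case: n mn => [|n] mn nm a0 [P [sP cP P1]].
      move=> _; apply: Ry; have [r [Rr Pr]] := cP 0%N.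
      suff -> : y = r by [].
      move: P1; rewrite (size1_polyC sP) hornerC Pr => /(congr1 ( *%R y)).
      by rewrite mulrA mulfV // mul1r mulr1.
    move=> DQ; have [Q [sQ cQ Q1]] := DQ.
    apply: (IH n m a) => //.
    have [q0 [Rq0 Q0]] := cQ 0%N; set u := (1 - pi * q0)^-1.
    have Ru : R u by apply: loc.
    pose Qr := \sum_(j < m) Q`_j.+1 *: 'X^(n - j) : {poly L}.
    have ER : (1 - pi * q0) * a ^+ n.+1 = Qr.[a].
      have -> : 1 - pi * q0 = \sum_(j < m) Q`_j.+1 * a^-1 ^+ j.+1.
        rewrite -Q1 (@horner_coef_wide _ m.+1) // big_ord_recl expr0 mulr1 Q0.
        by rewrite addrC addKr.
      rewrite mulr_suml horner_sum; apply: eq_bigr => j _.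
      rewrite hornerZ hornerXn -mulrA; congr (_ * _).
      have jn : (j <= n)%N by have := ltn_ord j; lia.
      rewrite -[in LHS](subnK (_ : (j.+1 <= n.+1)%N)) // subSS exprD mulrCA.
      by rewrite -exprMn mulVf // expr1n mulr1.
    have u1 : u * (1 - pi * q0) = 1.
      rewrite mulVf // subr_eq0; apply: contra_not_neq Ry => h.
      suff -> : y = q0 by [].
      by rewrite -[LHS]mulr1 h mulrA mulfV // mul1r.
    have [r [Rr Pn]] := cP n.+1.
    exists (\poly_(i < n.+1) P`_i + (pi * (r * u)) *: Qr); split.
    - rewrite (leq_trans (size_polyD _ _)) // geq_max size_poly /=.
      rewrite (leq_trans (size_scale_leq _ _)) //.
      apply: (leq_trans (size_sum _ _ _)); apply/bigmax_leqP => j _.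
      by rewrite (leq_trans (size_scale_leq _ _)) // size_polyXn ltnS leq_subr.
    - move=> i; rewrite coefD coefZ coef_poly coef_sum.
      have [r1 [Rr1 E1]] : exists r1, R r1 /\ (if (i < n.+1)%N then P`_i else 0) = pi * r1.
        case: ifP => _; first exact: cP.
        by exists 0; rewrite mulr0; split=> //; apply: sr0.
      rewrite E1.
      exists (r1 + r * u * \sum_(j < m) (Q`_j.+1 *: 'X^(n - j) : {poly L})`_i).
      split; last by rewrite mulrDr -!mulrA.
      apply: srD => //; apply: srM => //; first exact: srM.
      apply: sr_sum => // j _; rewrite coefZ coefXn.
      have [r2 [Rr2 ->]] := cQ j.+1.
      by apply: srM => //; [apply: srM|case: eqP => _; [apply: sr1|apply: sr0]].
    - rewrite hornerD hornerZ -ER (_ : (pi * (r * u)) * ((1 - pi * q0) * a ^+ n.+1)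
          = pi * r * (u * (1 - pi * q0)) * a ^+ n.+1); last by ring.
      rewrite u1 mulr1 -Pn -[RHS]P1 (@horner_coef_wide _ n.+2 P) //.
      rewrite big_ord_recr /= horner_poly; congr (_ + _).
  rewrite leqn0 addn_eq0 => /andP[/eqP-> /eqP->] a0 [P [sP cP P1]] _.
  apply: Ry; have [r [Rr Pr]] := cP 0%N.
  suff -> : y = r by [].
  move: P1; rewrite (size1_polyC sP) hornerC Pr => /(congr1 ( *%R y)).
  by rewrite mulrA mulfV // mul1r mulr1.
have DR a : ~ R a -> exists n, D a n.
  move=> /yin [p [Rp yp]]; exists (size p), (pi *: p); split.
  - by rewrite (leq_trans (size_scale_leq _ _)).
  - by move=> i; exists p`_i; rewrite coefZ.
  - by rewrite hornerZ -yp mulVf.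
move=> a; apply: contrapT => /not_orP[Ra Rai].
have a0 : a != 0 by apply: contra_not_neq Ra => ->; apply: sr0.
have [n Dn] := DR _ Ra; have [m Dm] := DR _ Rai.
exact: (key (n + m)%N n m a).
Qed.

Section ValuationRing.
Variables (L : fieldType) (R : set L).
Hypotheses (sR : subring R) (vR : forall a, R a \/ R a^-1).

(** * Algebraic elements over a discrete valuation ring *)

(** Divisibility by a valuation ring is a total preorder, so a finite family
    has a term dividing all the others. *)
Lemma dominant_term (I : eqType) (f : I -> L) (s : seq I) :
  s != [::] -> (forall i, i \in s -> f i != 0) ->
  exists2 i, i \in s & forall j, j \in s -> R (f j / f i).
Proof.
elim: s => [|i s IH] // _ f0.
have fi0 : f i != 0 by apply: f0; rewrite inE eqxx.
have [s0|s0] := eqVneq s [::].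
  exists i; first by rewrite inE eqxx.
  by move=> j; rewrite s0 inE => /eqP->; rewrite divff //; apply: sr1.
have [|j js jmax] := IH s0; first by move=> l ls; apply: f0; rewrite inE ls orbT.
have fj0 : f j != 0 by apply: f0; rewrite inE js orbT.
have [ij|] := vR (f i / f j).
  exists j; first by rewrite inE js orbT.
  by move=> l; rewrite inE => /orP[/eqP->//|]; apply: jmax.
rewrite invf_div => ji; exists i; first by rewrite inE eqxx.
move=> l; rewrite inE => /orP[/eqP->|/jmax lj]; first by rewrite divff //; apply: sr1.
by rewrite -(divfK fj0 (f l)) -[_ * f j / _]mulrA; apply: srM.
Qed.

Definition vunit a := R a /\ R a^-1.

Lemma vunitM a b : vunit a -> vunit b -> vunit (a * b).
Proof. by move=> [? ?] [? ?]; split; rewrite ?invfM; apply: srM. Qed.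

Lemma vunitV a : vunit a -> vunit a^-1.
Proof. by move=> [? ?]; split; rewrite ?invrK. Qed.

Lemma vunitX a n : vunit a -> vunit (a ^+ n).
Proof. by move=> [? ?]; split; rewrite -?exprVn; apply: srX. Qed.

Variables (F : fieldType) (e : {rmorphism F -> L}).

(** In the vanishing sum of the terms of p at a, the dominant term is minus the
    sum of the others, hence divisible by the dominant one among them. These two
    terms agree up to a unit, and their quotient is a power of a times a constant. *)
Lemma algebraic_value (p : {poly F}) a : a != 0 -> p != 0 ->
  root (map_poly e p) a ->
  exists n c, [/\ (0 < n < size p)%N, c != 0 & vunit (a ^+ n * e c)].
Proof.
move=> a0 p0 pa.
pose f (i : 'I_(size p)) := e p`_i * a ^+ i.
pose s : seq 'I_(size p) := [seq i : 'I_(size p) <- enum 'I_(size p) | p`_(i : nat) != 0].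
have sE i : (i \in s) = (p`_i != 0) by rewrite mem_filter mem_enum andbT.
have f0 i : i \in s -> f i != 0.
  by rewrite sE => pi; rewrite mulf_neq0 ?fmorph_eq0 // expf_neq0.
have sum0 : \sum_i f i = 0.
  by move: pa; rewrite rootE horner_coef size_map_poly => /eqP E;
    rewrite -[RHS]E; apply: eq_bigr => i _; rewrite coef_map.
have fz i : i \notin s -> f i = 0.
  by rewrite sE negbK => /eqP E; rewrite /f E rmorph0 mul0r.
have lt : ((size p).-1 < size p)%N by rewrite prednK // size_poly_gt0.
have [|i0 i0s i0max] := @dominant_term _ f s _ f0.
  apply/eqP => s0; have := sE (Ordinal lt).
  by rewrite s0 /= -lead_coefE lead_coef_eq0 p0.
pose s' := [seq i <- s | i != i0].
have f0' i : i \in s' -> f i != 0 by rewrite mem_filter => /andP[_]; apply: f0.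
have s'0 : s' != [::].
  apply/eqP => s0; have := f0 _ i0s; rewrite -sum0 (bigD1 i0) //= big1 ?addr0 ?eqxx //.
  move=> i ni; apply: fz; apply/negP => si.
  have : i \in s' by rewrite mem_filter ni.
  by rewrite s0.
have [i1 i1s i1max] := @dominant_term _ f s' s'0 f0'.
have /andP[ni i1s0] : (i1 != i0) && (i1 \in s) by move: i1s; rewrite mem_filter.
have U : vunit (f i1 / f i0).
  split; first exact: i0max.
  rewrite invf_div.
  have -> : f i0 = - \sum_(i | i != i0) f i.
    by apply/eqP; rewrite -addr_eq0; move: sum0; rewrite (bigD1 i0) //= => ->.
  rewrite mulNr mulr_suml; apply: srN => //; apply: sr_sum => // i nii.
  have [si|/fz->] := boolP (i \in s); last by rewrite mul0r; apply: sr0.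
  by apply: i1max; rewrite mem_filter nii.
have ltP (i j : 'I_(size p)) : (i < j)%N -> i \in s -> j \in s -> vunit (f j / f i) ->
   exists n c, [/\ (0 < n < size p)%N, c != 0 & vunit (a ^+ n * e c)].
  rewrite !sE => ij pi pj h; exists (j - i)%N, (p`_j / p`_i); split.
  - by have := ltn_ord j; lia.
  - by rewrite mulf_neq0 ?invr_eq0.
  - move: h; rewrite /f; congr vunit.
    have -> : a ^+ j = a ^+ (j - i) * a ^+ i by rewrite -exprD subnK // ltnW.
    rewrite fmorph_div.
    have ai0 : a ^+ i != 0 by rewrite expf_neq0.
    have epi : e p`_i != 0 by rewrite fmorph_eq0.
    by field; rewrite ai0 epi.
have [lt1|lt1|E] := ltngtP i0 i1.
- exact: (ltP i0 i1).
- by apply: (ltP i1 i0) => //; rewrite -invf_div; apply: vunitV.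
- by move: ni; rewrite -val_eqE /= E eqxx.
Qed.

End ValuationRing.

(** A subring maximal among those that contain the valuation ring of v but not
    1 / t, for t of value 1, is a valuation ring lying over that of v. A power
    a^n with n at most d agrees up to a unit with a power of t, so raising to
    the power d! makes all values integers. *)
Lemma extend_valuation (F L : fieldType) (e : {rmorphism F -> L}) (d : nat) :
  (forall a, exists p : {poly F},
     [/\ p != 0, (size p <= d.+1)%N & root (map_poly e p) a]) ->
  forall v : valuation F, exists (w : L -> int) (E : nat),
    [/\ preval w, (0 < E)%N & forall a, w (e a) = E%:Z * v a].
Proof.
move=> alg v; have pv := valuation_preval v.
have [t t0 vt] := val_normalized v.
have et0 : e t != 0 by rewrite fmorph_eq0.
have [||R [sR R0R Ry Rmax]] := @max_subring L [set e a | a in [set a | vge v a 0]] (e t)^-1.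
- split.
  + by exists 1; rewrite ?rmorph1 //; apply: vge1.
  + move=> _ _ [a a0 <-] [b b0 <-]; exists (a - b); last by rewrite rmorphB.
    exact: vgeB.
  + move=> _ _ [a a0 <-] [b b0 <-]; exists (a * b); last by rewrite rmorphM.
    exact: vgeM0.
- move=> [a a0]; rewrite -fmorphV => /fmorph_inj aE; case: a0.
    by rewrite aE => /eqP; rewrite invr_eq0 (negPf t0).
  by rewrite aE pvalV // vt.
have Re a : vge v a 0 -> R (e a) by move=> a0; apply: R0R; exists a.
have vR : forall a, R a \/ R a^-1.
  apply: (max_subring_valuation sR Ry _ Rmax).
  by rewrite invrK; apply: Re; right; rewrite vt.
have reR a : a != 0 -> R (e a) -> 0 <= v a.
  move=> a0 Ra; rewrite leNgt; apply/negP => lt; apply: Ry.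
  have -> : (e t)^-1 = e a * e (a^-1 / t).
    by rewrite -rmorphM mulrA mulfV // mul1r fmorphV.
  apply: srM => //; apply: Re; right.
  by rewrite pvalM ?invr_eq0 // !pvalV // vt; lia.
have reU a : a != 0 -> vunit R (e a) -> v a = 0.
  move=> a0 [/reR-/(_ a0) h1]; rewrite -fmorphV => /reR; rewrite invr_eq0 pvalV //.
  by move=> /(_ a0); lia.
have Ure a : a != 0 -> v a = 0 -> vunit R (e a).
  by move=> a0 va; split; rewrite -?fmorphV; apply: Re; right; rewrite ?pvalV ?va.
pose M := d`!; have M0 : (0 < M)%N := fact_gt0 d.
pose val a r := vunit R (a ^+ M * e (t ^ (- r))).
have tz n : t ^ n != 0 by rewrite expfz_neq0.
have vtz n : v (t ^ n) = n by rewrite pvalMz // vt mulr1.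
have ex_val a : exists r, a != 0 -> val a r.
  have [->|a0] := eqVneq a 0; first by exists 0.
  have [p [p0 sp pa]] := alg a.
  have [n [c [nlt c0 U]]] := algebraic_value sR vR a0 p0 pa.
  have U1 : vunit R (a ^+ n * e (t ^ v c)).
    have -> : a ^+ n * e (t ^ v c) = a ^+ n * e c * e (t ^ v c / c).
      by rewrite -mulrA -rmorphM mulrCA mulfV // mulr1.
    apply: vunitM => //; apply: Ure; first by rewrite mulf_neq0 ?invr_eq0.
    by rewrite pvalM ?invr_eq0 // pvalV // vtz; lia.
  have nM : (n %| M)%N by apply: dvdn_fact; lia.
  exists (- (v c * (M %/ n)%N%:Z)) => _; rewrite /val opprK.
  have := vunitX sR (M %/ n)%N U1.
  by rewrite exprMn -exprM mulnC divnK // -rmorphXn /= (exprnP (t ^ v c)) exprz_exp.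
have [w0 w0P] := choice ex_val.
pose w a := if a == 0 then 0 else w0 a.
have wP a : a != 0 -> val a (w a) by move=> a0; rewrite /w (negPf a0); apply: w0P.
have val_uniq a r s : a != 0 -> val a r -> val a s -> r = s.
  move=> a0 ar as_; have := vunitM sR ar (vunitV as_).
  rewrite invfM mulrACA mulfV ?expf_neq0 // mul1r -fmorph_div => /reU.
  by rewrite mulf_neq0 ?invr_eq0 // pvalM ?invr_eq0 // pvalV // !vtz => /(_ isT); lia.
have wE a r : a != 0 -> val a r -> w a = r.
  by move=> a0 ar; apply: (val_uniq a) => //; apply: wP.
have wM a b : a != 0 -> b != 0 -> w (a * b) = w a + w b.
  move=> a0 b0; apply: wE; first by rewrite mulf_neq0.
  rewrite /val exprMn opprD expfzDr // rmorphM mulrACA.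
  by apply: vunitM => //; apply: wP.
have wR a : a != 0 -> (R a <-> 0 <= w a).
  move=> a0; have [U1 U2] := wP a a0; split=> [Ra|wa].
    rewrite -(vtz (w a)); apply: reR => //.
    have -> : e (t ^ w a) = a ^+ M * (a ^+ M * e (t ^ (- w a)))^-1.
      by rewrite invfM mulrA mulfV ?expf_neq0 // mul1r -fmorphV invr_expz opprK.
    by apply: (srM sR) => //; apply: (srX sR).
  have RM : R (a ^+ M).
    have -> : a ^+ M = a ^+ M * e (t ^ (- w a)) * e (t ^ w a).
      by rewrite -mulrA -rmorphM -expfzDr // addNr expr0z rmorph1 mulr1.
    by apply: srM => //; apply: Re; right; rewrite vtz.
  have [//|Rai] := vR a.
  have -> : a = a ^+ M * a^-1 ^+ M.-1.
    rewrite -{1}(prednK M0) exprSr mulrAC -exprMn mulfV // expr1n mul1r //.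
  by apply: srM => //; apply: srX.
exists w, M; split=> //.
- split=> //; first by rewrite /w eqxx.
  have half a b : a != 0 -> b != 0 -> a + b != 0 -> w a <= w b -> w a <= w (a + b).
    move=> a0 b0 ab0 le.
    have ba0 : b / a != 0 by rewrite mulf_neq0 ?invr_eq0.
    have wba : w b = w a + w (b / a) by rewrite -wM // mulrCA mulfV // mulr1.
    have E : a + b = a * (1 + b / a) by rewrite mulrDr mulr1 mulrCA mulfV // mulr1.
    have n0 : 1 + b / a != 0 by apply: contraNneq ab0 => h; rewrite E h mulr0.
    rewrite E wM // lerDl; apply/wR => //; apply: srD => //; first exact: sr1.
    by apply/wR => //; lia.
  move=> a b a0 b0 ab0; rewrite ge_min; have [le|lt] := leP (w a) (w b).
    by rewrite half.
  by rewrite orbC addrC half 1?addrC // ltW.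
- move=> a; have [->|a0] := eqVneq a 0; first by rewrite rmorph0 /w eqxx Defs.val0 mulr0.
  apply: wE; first by rewrite fmorph_eq0.
  rewrite /val -rmorphXn -rmorphM; apply: Ure; first by rewrite mulf_neq0 ?expf_neq0.
  by rewrite pvalM ?expf_neq0 // pvalX // vtz; lia.
Qed.

(** * Approximation for finitely many valuations *)

HB.instance Definition _ (F : fieldType) := gen_eqMixin (valuation F).

(** If the valuation ring of v1 is contained in that of v2, then units for v1
    are units for v2, so v2 is determined by its value at an element of v1-value
    1; both being normalized, they agree. *)
Lemma valuation_incomparable (F : fieldType) (v1 v2 : valuation F) :
  v1 != v2 -> exists2 a, 0 <= v1 a & v2 a < 0.
Proof.
move=> ne; apply: contrapT => H; move/eqP: ne; apply; apply: valuation_eq => a.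
have p1 := valuation_preval v1; have p2 := valuation_preval v2.
have le b : 0 <= v1 b -> 0 <= v2 b.
  by move=> b1; rewrite leNgt; apply/negP => b2; apply: H; exists b.
have [p p0 vp] := val_normalized v1; have [q q0 vq] := val_normalized v2.
have E b : b != 0 -> v2 b = v1 b * v2 p.
  move=> b0; have pz n : p ^ n != 0 by rewrite expfz_neq0.
  have := le (b / p ^ v1 b); have := le (p ^ v1 b / b).
  by rewrite !pvalM ?invr_eq0 // !pvalV // !pvalMz // vp; lia.
have := E _ q0; have := le p; rewrite vp vq => /(_ isT) h h1.
have [->|/E ->] := eqVneq a 0; first by rewrite !Defs.val0.
move: (v1 q) (v2 p) h h1 => x y y0 xy.
have y1 : 0 < y by case: ltgtP y0 xy => // <-; rewrite mulr0.
have x0 : 0 < x by rewrite -(pmulr_lgt0 _ y1) -xy.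
by have -> : y = 1; [nia|rewrite mulr1].
Qed.

Lemma seq_bound (T : eqType) (s : seq T) (f : T -> int) :
  exists r : nat, forall x, x \in s -> f x <= r%:Z.
Proof.
elim: s => [|x s [r IH]]; first by exists 0%N.
exists (r + `|f x|)%N => y; rewrite inE => /orP[/eqP->|/IH]; lia.
Qed.

(** Induction in the style of Artin and Whaples: an element a that works for
    all valuations but v is corrected by an element b that separates v0 from v,
    using a^r b if a is integral at v, and b a^r / (1 + a^r) if it has a pole. *)
Lemma valuation_separation (F : fieldType) (v0 : valuation F) (vs : seq (valuation F)) :
  v0 \notin vs -> exists a, v0 a < 0 /\ forall v, v \in vs -> 0 < v a.
Proof.
elim: vs => [|v vs IH].
  have [p p0 vp] := val_normalized v0.
  by exists p^-1; rewrite pvalV ?vp; [split|apply: valuation_preval].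
rewrite inE negb_or => /andP[ne /IH [a [v0a va]]].
have [b1 b10 b1v] : exists2 a, 0 <= v a & v0 a < 0.
  by apply: valuation_incomparable; rewrite eq_sym.
have [b2 b20 b2v] := valuation_incomparable ne.
have pv := valuation_preval.
have nz (w : valuation F) c : w c != 0 -> c != 0.
  by move=> wc; apply: contraNneq wc => ->; rewrite Defs.val0.
have b1nz : b1 != 0 by apply: (nz v0); lia.
have b2nz : b2 != 0 by apply: (nz v); lia.
have anz : a != 0 by apply: (nz v0); lia.
pose b := b1 / b2.
have bnz : b != 0 by rewrite mulf_neq0 ?invr_eq0.
have v0b : v0 b < 0 by rewrite pvalM ?invr_eq0 // pvalV //; lia.
have vb : 0 < v b by rewrite pvalM ?invr_eq0 // pvalV //; lia.
have [r rP] := seq_bound vs (fun w : valuation F => - w b).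
pose c := a ^+ r.+1.
have cnz : c != 0 by rewrite expf_neq0.
have v0c : v0 c < 0 by rewrite pvalX //; nia.
have vsc w : w \in vs -> 0 < w c + w b.
  by move=> ws; rewrite pvalX //; have := rP _ ws; have := va _ ws; nia.
have [le|lt] := leP 0 (v a).
  exists (c * b); split; first by rewrite pvalM //; lia.
  move=> w; rewrite inE pvalM // => /orP[/eqP->|/vsc//].
  by rewrite pvalX //; nia.
have vc : v c < 0 by rewrite pvalX //; nia.
have D (w : valuation F) : w c < 0 -> 1 + c != 0 /\ w (1 + c) = w c.
  move=> wc; rewrite addrC; apply: pvalD_eq => //.
  by right; rewrite pval1 //; lia.
have P (w : valuation F) : 0 < w c -> w (1 + c) = 0.
  move=> wc; rewrite -(pval1 (pv _ w)).
  have [] // := @pvalD_eq _ _ (pv _ w) 1 c (oner_neq0 F).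
  by right; rewrite pval1 //; lia.
have [c1nz v0c1] := D _ v0c; have [_ vc1] := D _ vc.
exists (b * (c / (1 + c))).
have E (w : valuation F) : w (b * (c / (1 + c))) = w b + w c - w (1 + c).
  by rewrite !pvalM ?pvalV ?mulf_neq0 ?invr_eq0 //; lia.
split; first by rewrite E; lia.
move=> w; rewrite inE => /orP[/eqP->|ws]; rewrite E; first by lia.
have := vsc _ ws; have := va _ ws => wa; rewrite P; last by rewrite pvalX //; nia.
lia.
Qed.

(** Apply the function a / (1 + a) to a separating element a: it is close to 1
    at the poles of a and small at its zeros. *)
Lemma valuation_idempotent (F : fieldType) (v0 : valuation F) (vs : seq (valuation F)) :
  v0 \notin vs ->
  exists u, vge v0 (u - 1) 1 /\ forall v, v \in vs -> vge v u 1.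
Proof.
move=> /valuation_separation [a [v0a va]].
have pv := valuation_preval v0.
have a0 : a != 0.
  by apply: contraTneq v0a => ->; rewrite Defs.val0.
have [a1 v0a1] : 1 + a != 0 /\ v0 (1 + a) = v0 a.
  by rewrite addrC; apply: pvalD_eq => //; right; rewrite pval1 //; lia.
exists (a / (1 + a)); split.
  have -> : a / (1 + a) - 1 = - (1 + a)^-1 by field.
  by apply: vgeN => //; right; rewrite pvalV // v0a1; lia.
move=> v vvs; have pv' := valuation_preval v; right.
rewrite pvalM ?invr_eq0 // pvalV //.
have [|_ ->] := @pvalD_eq _ _ pv' 1 a (oner_neq0 F).
  by right; rewrite pval1 //; have := va _ vvs; lia.
by rewrite pval1 //; have := va _ vvs; lia.
Qed.

Definition above (E F : fieldType) (j : E -> F) (v : valuation E) (w : valuation F) :=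
  exists e, lies_above j v w e.

Section Above.
Variables (F : fieldType) (L : fieldExtType F) (v : valuation F).

(** Elements close to 1 at one valuation and to 0 at all the others are linearly
    independent: in a relation, look at the valuation attached to a coefficient
    of least value. *)
Lemma size_above (vs : seq (valuation L)) : uniq vs ->
  (forall w, w \in vs -> above (in_alg L) v w) -> (size vs <= \dim {:L})%N.
Proof.
move=> uvs vsP; rewrite leqNgt; apply/negP => lt.
have ex w : exists u, w \in vs -> vge w (u - 1) 1 /\
    forall w', w' \in vs -> w' != w -> vge w' u 1.
  have [ws|] := boolP (w \in vs); last by exists 0.
  have [|u [u1 u0]] := @valuation_idempotent _ w (rem w vs).
    by rewrite mem_rem_uniq // inE eqxx.
  exists u => _; split=> // w' w's ne; apply: u0.
  by rewrite mem_rem_uniq // inE ne.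
have [u uP] := choice ex.
pose X := map_tuple u (in_tuple vs).
have /freeP : ~~ free X.
  apply/negP; rewrite /free size_tuple => /eqP E.
  by have := dimvS (subvf <<X>>); rewrite E leqNgt lt.
apply => k k0 i; apply: contrapT => /eqP ki.
have [i0 ki0 imin] := @Order.TotalTheory.arg_minP _ _ _ i (fun i => k i != 0) (fun i => v (k i)) ki.
set w := tnth (in_tuple vs) i0.
have ws : w \in vs by rewrite -[vs]/(val (in_tuple vs)) mem_tnth.
have pw := valuation_preval w.
have [e [e0 we]] := vsP _ ws.
have XE (l : 'I_(size vs)) : X`_l = u (nth w vs l) by rewrite (nth_map w).
have wE l : tnth (in_tuple vs) l = nth w vs l := tnth_nth w (in_tuple vs) l.
have Xi0 : X`_i0 = u w by rewrite XE -wE.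
have [ui1 _] := uP _ ws; have [ui0 wui] := unit_near1 pw ui1.
have kA0 : k i0 *: X`_i0 != 0 by rewrite Xi0 scaler_eq0 negb_or ki0.
move/eqP: k0; rewrite (bigD1 i0) //=; apply/negP.
have wk l : w (k l *: 1) = e%:Z * v (k l) by rewrite -[_ *: 1]/(in_alg L _) we.
apply: (proj1 (pvalD_eq pw kA0 _)); apply: vge_sum => // l ne.
rewrite Xi0 -[u w]mul1r scalerAl pvalM ?wui ?addr0 //; last first.
  by rewrite scaler_eq0 negb_or ki0 oner_neq0.
rewrite wk -[X`_l]mul1r scalerAl.
have [->|kl] := eqVneq (k l) 0; first by left; rewrite scale0r mul0r.
apply: (vge_le (n := e%:Z * v (k l) + 1)).
  by rewrite lerD2r; have := imin _ kl; nia.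
apply: vgeM => //; first by right; rewrite wk.
have [_] := uP (tnth (in_tuple vs) l) (mem_tnth _ _).
rewrite XE -wE; apply=> //.
apply: contraNneq ne => E; apply/eqP/val_inj/eqP.
by rewrite /= -(nth_uniq w (ltn_ord l) (ltn_ord i0) uvs) -!wE -E.
Qed.

Lemma finite_above : exists vs : seq (valuation L),
  forall w, w \in vs <-> above (in_alg L) v w.
Proof.
pose P r := `[< exists vs : seq (valuation L), [/\ uniq vs,
  forall w, w \in vs -> above (in_alg L) v w & size vs = r] >].
have exP : exists r, P r by exists 0%N; apply/asboolP; exists [::].
have [r|r /asboolP[vs [uvs vsP sz]] rmax] := @ex_maxnP P (\dim {:L}) exP.
  by move=> /asboolP[vs [uvs vsP <-]]; apply: size_above.
exists vs => w; split; first exact: vsP.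
move=> wab; apply: contrapT => /negP nw.
have /rmax : P r.+1; last by rewrite ltnn.
apply/asboolP; exists (w :: vs); split; rewrite /= ?nw ?sz //.
by move=> w'; rewrite inE => /orP[/eqP->//|/vsP].
Qed.

(** Divisibility at w is measured in units of the ramification index, that is,
    by powers of an element of F. *)
Lemma above_idempotent (v0 : valuation L) (C : nat) :
  exists u, vge v0 (u - 1) 1 /\
    forall w e, w != v0 -> lies_above (in_alg L) v w e -> vge w u (C%:Z * e%:Z).
Proof.
have [vs vsP] := finite_above.
pose vs' := [seq w <- vs | w != v0].
have [|u [u1 u0]] := @valuation_idempotent _ v0 vs'.
  by rewrite mem_filter eqxx.
have [t t0 vt] := val_normalized v.
have [r rP] := seq_bound vs' (fun w : valuation L => w (t%:A)).
have p0 := valuation_preval v0.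
have v0u : vge v0 u 0 by have [_ E] := unit_near1 p0 u1; right; rewrite E.
exists (u ^+ (C * r)); split.
  rewrite subrX1 -[X in vge _ _ X]addr0; apply: vgeM => //.
  by apply: vge_sum => // i _; apply: vgeX.
move=> w e ne we; have ws : w \in vs'.
  by rewrite mem_filter ne; apply/vsP; exists e.
have pw := valuation_preval w.
have := rP _ ws; case: we => e0 /(_ t) /=; rewrite vt mulr1 => -> er.
case: (u0 _ ws) => [->|wu].
  rewrite expr0n; case: eqP => [Cr0|_]; last by left.
  by right; rewrite pval1 //; nia.
right; rewrite pvalX //; apply: (@le_trans _ _ (C * r)%N%:Z).
  by rewrite PoszM ler_wpM2l.
by rewrite ler_peMr.
Qed.

End Above.

(** * Galois closures *)

Lemma irreducible_factor (L : fieldType) (p : {poly L}) : (1 < size p)%N ->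
  exists2 r, r %| p & irreducible_poly r.
Proof.
move=> sp.
pose P n := `[< exists r : {poly L}, [/\ r %| p, (1 < size r)%N & size r = n] >].
have exP : exists n, P n by exists (size p); apply/asboolP; exists p; rewrite dvdpp.
case: (ex_minnP exP) => n /asboolP[r [rp sr <-]] rmin.
exists r => //; split=> // q sq qr.
have p0 : p != 0 by rewrite -size_poly_gt0; lia.
have r0 : r != 0 by rewrite -size_poly_gt0; lia.
have q0 : q != 0 by apply: (dvdpN0 qr).
rewrite -dvdp_size_eqp // eqn_leq dvdp_leq //= rmin //.
apply/asboolP; exists q; split=> //; first exact: dvdp_trans qr rp.
by rewrite ltn_neqAle eq_sym sq size_poly_gt0.
Qed.

Lemma splits_in_extension (n : nat) (L : fieldType) (p : {poly L}) :
  p != 0 -> (size p <= n)%N ->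
  exists (E : fieldExtType L) (ys : seq E),
    map_poly (in_alg E) p %= \prod_(y <- ys) ('X - y%:P).
Proof.
elim: n => [|n IH] in L p * => p0 sp.
  by move: p0; rewrite -size_poly_eq0; case: (size p) sp.
have [p1|p1] := leqP (size p) 1.
  exists L^o, [::]; rewrite big_nil -size_poly_eq1 size_map_poly.
  by rewrite eqn_leq p1 size_poly_gt0.
have [r rp irr] := irreducible_factor p1.
have [K _ [x rx _]] := irredp_FAdjoin irr.
have /factor_theorem[q Dp] : root (map_poly (in_alg K) p) x.
  by rewrite -(divpK rp) rmorphM rootM rx orbT.
have pK0 : map_poly (in_alg K) p != 0 by rewrite map_poly_eq0.
have q0 : q != 0 by apply: contraNneq pK0 => q0; rewrite Dp q0 mul0r.
have sq : (size q <= n)%N.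
  rewrite -(size_map_poly (in_alg K)) Dp size_mul ?polyXsubC_eq0 // size_XsubC in sp.
  by rewrite addn2 in sp.
have [E [zs Dq]] := IH K q q0 sq.
exists (baseFieldType E), ((in_alg E x : baseFieldType E) :: zs).
have -> : map_poly (in_alg (baseFieldType E)) p
        = map_poly (in_alg E) (map_poly (in_alg K) p) :> {poly E}.
  by rewrite -map_poly_comp; apply: eq_map_poly => a; rewrite /= baseField_scaleE.
rewrite Dp rmorphM /= rmorphB /= map_polyX map_polyC /= mulrC big_cons.
exact: eqp_mull.
Qed.

Lemma splits_above_extension (F : fieldType) (L : fieldExtType F) (p : {poly L}) :
  p != 0 ->
  exists (E : fieldExtType F) (g : {rmorphism L -> E}) (ys : seq E),
    (forall a, g a%:A = a%:A) /\ map_poly g p %= \prod_(y <- ys) ('X - y%:P).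
Proof.
move=> p0; have [E [ys Dys]] := splits_in_extension p0 (leqnn _).
by exists (baseFieldType E), (in_alg E), ys.
Qed.

(** Split, over L, the product of the minimal polynomials of a basis of L / F.
    The roots generate over F a splitting field; it contains the image of L
    because the basis elements are among the roots. *)
Lemma galois_closure (F : fieldType) (L : fieldExtType F) :
  exists (N : splittingFieldType F) (f : {rmorphism L -> N}),
    forall a, f a%:A = a%:A.
Proof.
pose b := vbasis {:L}.
have ex_p (i : 'I_(\dim {:L})) : exists p : {poly F}, p != 0 /\
    root (map_poly (in_alg L) p) b`_i.
  by have [p p0 pi] := algebraicOver_ext b`_i; exists p.
have [p pP] := choice ex_p.
pose P : {poly F} := \prod_i p i.
have P0 : P != 0 by apply/prodf_neq0 => i _; have [] := pP i.
have PL0 : map_poly (in_alg L) P != 0 by rewrite map_poly_eq0.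
have [E [g [ys [gE Dys]]]] := splits_above_extension PL0.
pose M := [aspace of <<1 & ys>>%VS].
have ysM y : y \in ys -> y \in M by move=> yys; apply: seqv_sub_adjoin.
have LM a : g a \in M.
  rewrite (coord_vbasis (memvf a)) rmorph_sum; apply: rpred_sum => i _.
  rewrite -/b -mulr_algl rmorphM gE mulr_algl; apply: rpredZ; apply: ysM.
  rewrite -root_prod_XsubC -(eqp_root Dys) fmorph_root /P rmorph_prod.
  by rewrite (bigD1 i) //= rootM; have [_ ->] := pP i.
have splitM : SplittingField.axiom (subvs_of M).
  have [zs Dzs] : exists zs : seq (subvs_of M), map vsval zs = ys.
    exists (map (vsproj M) ys); rewrite -map_comp map_id_in // => y yys.
    by rewrite /= vsprojK ?ysM.
  exists (map_poly (in_alg (subvs_of M)) P); first by apply/polyOver1P; exists P.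
  exists zs.
    pose toE : {rmorphism subvs_of M -> E} := vsval.
    rewrite -(eqp_map toE).
    have -> : map_poly toE (map_poly (in_alg (subvs_of M)) P)
            = map_poly g (map_poly (in_alg L) P).
      rewrite -!map_poly_comp; apply: eq_map_poly => a /=.
      by rewrite gE algid1.
    apply: (eqp_trans Dys).
    suff -> : map_poly toE (\prod_(z <- zs) ('X - z%:P)) = \prod_(y <- ys) ('X - y%:P).
      exact: eqpxx.
    rewrite rmorph_prod -[ys in RHS]Dzs big_map; apply: eq_bigr => z _.
    by rewrite rmorphB /= map_polyX map_polyC.
  pose toE := linfun (vsval : subvs_of M -> E).
  apply/vspaceP => u; rewrite memvf.
  have : val u \in (toE @: <<1 & zs>>)%VS.
    rewrite aimg_adjoin_seq aimg1.
    have -> : map toE zs = ys by rewrite -Dzs; apply: eq_map => z; rewrite lfunE.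
    exact: (valP u).
  by case/memv_imgP => z zs_z; rewrite lfunE => /val_inj->.
pose N : splittingFieldType F := HB.pack_for (splittingFieldType F) (subvs_of M)
  (FieldExt_isSplittingField.Build F (subvs_of M) splitM).
pose f (a : L) : subvs_of M := vsproj M (g a).
have fK a : vsval (f a) = g a by rewrite vsprojK.
have fD : zmod_morphism f.
  by move=> a c; apply: val_inj; rewrite /= !fK rmorphB.
have fM : monoid_morphism f.
  by split=> [|a c]; apply: val_inj; rewrite /= !fK ?rmorph1 ?rmorphM ?algid1.
pose fZ := GRing.isZmodMorphism.Build L (subvs_of M) f fD.
pose fMul := GRing.isMonoidMorphism.Build L (subvs_of M) f fM.
pose fR : {rmorphism L -> subvs_of M} := HB.pack f fZ fMul.
by exists N, fR => a; apply: val_inj; rewrite /= fK gE algid1.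
Qed.

(** * The trace *)

(** The embedding of L in a Galois closure with its automorphisms over F. The
    map cj_trace sums over all automorphisms of the closure, which is the trace
    of L / F times the degree of the closure over L; in characteristic zero this
    multiple serves as well as the trace. *)
Record galois_data (F : fieldType) (L : fieldExtType F) := GaloisData {
  cj_field : fieldType;
  cj_base : {rmorphism F -> cj_field};
  cj_emb : {rmorphism L -> cj_field};
  cj_num : nat;
  cj_aut : 'I_cj_num -> {rmorphism cj_field -> cj_field};
  cj_trace : L -> F;
  cj_deg : nat;
  cj_emb_base : forall a, cj_emb a%:A = cj_base a;
  cj_aut_base : forall s a, cj_aut s (cj_base a) = cj_base a;
  cj_aut_id : exists s, forall a, cj_aut s a = a;
  cj_traceE : forall a, cj_base (cj_trace a) = \sum_s cj_aut s (cj_emb a);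
  cj_algebraic : forall a, exists p : {poly F},
    [/\ p != 0, (size p <= cj_deg.+1)%N & root (map_poly cj_base p) a] }.

Lemma galois_data_exist (F : fieldType) (L : fieldExtType F) :
  [pchar F] =i pred0 -> inhabited (galois_data L).
Proof.
move=> ch; have [N [f fE]] := galois_closure L.
have galN : galois 1 {:N}.
  apply/and3P; split; [exact: subvf| |exact: normalFieldf].
  by apply/separableP => y _; apply: pcharf0_separable => p; rewrite pchar_lalg ch.
pose G := 'Gal({:N} / 1)%g.
have ex_tr a : exists c : F, \sum_(x in G) x (f a) = c%:A.
  by apply/vlineP; apply: (mem_galTrace galN); apply: memvf.
have [T TE] := choice ex_tr.
have autR (x : gal_of {:N}) : exists h : {rmorphism N -> N}, forall a, h a = x a.
  by exists (x : 'AEnd(N)).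
have [aut autE] := choice autR.
have sumE a : \sum_(x in G) x a = \sum_(s < #|G|) aut (enum_val s) a.
  by rewrite big_enum_val; apply: eq_bigr => s _; rewrite autE.
constructor; apply: (@GaloisData F L N (in_alg N) f #|G|
  (fun s => aut (enum_val s)) T (\dim {:N})) => //.
- move=> s a; rewrite autE (@fixed_gal _ _ 1%AS {:N}%AS) ?subvf ?enum_valP //.
  by apply/vlineP; exists a.
- exists (enum_rank_in (group1 _) (1%g : gal_of {:N})) => a.
  by rewrite autE enum_rankK_in ?group1 // gal_id.
- by move=> a; rewrite -sumE TE.
- move=> a; have /polyOver1P[p Dp] := minPolyOver 1%AS a.
  exists p; split; last by rewrite -Dp root_minPoly.
    by rewrite -(map_poly_eq0 (in_alg N)) -Dp monic_neq0 ?monic_minPoly.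
  rewrite -(size_map_poly (in_alg N)) -Dp size_minPoly ltnS.
  by rewrite adjoin_degreeE dimv1 divn1 dimvS // subvf.
Qed.

Section Trace.
Variables (F : fieldType) (L : fieldExtType F) (cj : galois_data L).
Hypothesis ch : [pchar F] =i pred0.
Local Notation T := (cj_trace cj).

Lemma traceD a b : T (a + b) = T a + T b.
Proof.
apply: (fmorph_inj (cj_base cj)); rewrite rmorphD /= !cj_traceE -big_split.
by apply: eq_bigr => s _; rewrite /= !rmorphD.
Qed.

Lemma traceZ c a : T (c *: a) = c * T a.
Proof.
apply: (fmorph_inj (cj_base cj)); rewrite rmorphM /= !cj_traceE mulr_sumr.
apply: eq_bigr => s _; rewrite -mulr_algl !rmorphM cj_emb_base.
by rewrite [cj_aut s (cj_base cj c)]cj_aut_base.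
Qed.

Lemma trace0 : T 0 = 0.
Proof. by rewrite -(scale0r (0 : L)) traceZ mul0r. Qed.

Lemma trace_sum (I : Type) (r : seq I) (P : pred I) (f : I -> L) :
  T (\sum_(i <- r | P i) f i) = \sum_(i <- r | P i) T (f i).
Proof. by apply: (big_morph T) => [a b|]; [apply: traceD|apply: trace0]. Qed.

Lemma trace1_neq0 : T 1 != 0.
Proof.
rewrite -(fmorph_eq0 (cj_base cj)) cj_traceE.
under eq_bigr do rewrite !rmorph1.
have [s _] := cj_aut_id cj.
rewrite sumr_const card_ord -(rmorph_nat (cj_base cj)) fmorph_eq0.
by have /pcharf0P -> := ch; rewrite -lt0n (leq_ltn_trans _ (ltn_ord s)).
Qed.

(** A conjugate of a valuation of the closure restricts on L to a multiple of
    some normalized valuation above v, not always the same one. *)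
Lemma conj_valuation (v : valuation F) (w : cj_field cj -> int) (E : nat) s :
  preval w -> (0 < E)%N -> (forall a, w (cj_base cj a) = E%:Z * v a) ->
  exists (v' : valuation L) (e r : nat), [/\ lies_above (in_alg L) v v' e,
    (0 < r)%N, (r * e)%N = E &
    forall a, w (cj_aut s (cj_emb cj a)) = r%:Z * v' a].
Proof.
move=> pw E0 wE; have [t t0 vt] := val_normalized v.
have wF a : w (cj_aut s (cj_emb cj a%:A)) = E%:Z * v a.
  by rewrite cj_emb_base [cj_aut s _]cj_aut_base wE.
have [||r [v' [r0 H]]] := @preval_normalize L (w \o (cj_aut s \o cj_emb cj)).
- exact: preval_comp.
- by exists t%:A; rewrite /= wF vt mulr1; lia.
pose e := `|v' t%:A|%N.
have v't0 : 0 < v' t%:A.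
  by have := H t%:A; rewrite /= wF vt mulr1 => h; rewrite -(pmulr_rgt0 _ (_ : 0 < r%:Z)) // -h.
have eE : (r * e)%N = E.
  by have := H t%:A; rewrite /= wF vt mulr1 /e => h; apply/eqP; rewrite -eqz_nat PoszM gtz0_abs // h.
exists v', e, r; split=> //; split; first by rewrite /e; lia.
move=> a; have := H a%:A; rewrite /= wF -eE PoszM -mulrA => /(mulfI _) -> //.
by lia.
Qed.

(** The hypothesis says that a / t^(n-1), with t of v-value 1, has positive value
    at every v' above v, hence so do its conjugates and its trace. As v is
    integer-valued, positive means at least 1. Poles of order less than the
    ramification index are thus lost in the trace. *)
Lemma trace_vge (v : valuation F) (a : L) (n : int) :
  (forall v' e, lies_above (in_alg L) v v' e -> vge v' a (e%:Z * (n - 1) + 1)) ->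
  vge v (T a) n.
Proof.
move=> H; have [w [E [pw E0 wE]]] := extend_valuation (@cj_algebraic _ _ cj) v.
have : vge w (cj_base cj (T a)) (E%:Z * (n - 1) + 1).
  rewrite cj_traceE; apply: vge_sum => // s _.
  have [v' [e [r [v'e r0 re wE']]]] := conj_valuation s pw E0 wE.
  case: (H _ _ v'e) => [->|h]; first by left; rewrite !rmorph0.
  right; rewrite wE' -re PoszM.
  apply: (@le_trans _ _ (r%:Z * (e%:Z * (n - 1) + 1))); first by nia.
  by rewrite ler_pM2l.
case=> [/eqP|]; first by rewrite fmorph_eq0 => /eqP; left.
by rewrite wE => h; right; nia.
Qed.

(** Modulo the maximal ideal, each conjugate of u is 0 or 1. So the trace is
    congruent to the number of conjugates close to 1, which is positive for
    a valuation of the closure that extends v0, and a unit since v vanishes on positive integers. *)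
Lemma trace_idempotent (v : valuation F) (v0 : valuation L) (u : L) :
  (forall n, (0 < n)%N -> v n%:R = 0) -> above (in_alg L) v v0 ->
  vge v0 (u - 1) 1 ->
  (forall v', above (in_alg L) v v' -> v' != v0 -> vge v' u 1) ->
  T u != 0 /\ v (T u) = 0.
Proof.
move=> vn [e0 [e00 v0e]] u1 u0.
have [|w [E' [pw E'0 wE']]] := @extend_valuation _ _ (cj_emb cj) (cj_deg cj) _ v0.
  move=> a; have [p [p0 sp pa]] := cj_algebraic a.
  exists (map_poly (in_alg L) p); rewrite map_poly_eq0 size_map_poly; split=> //.
  rewrite -map_poly_comp; congr (root _ a): pa; apply: eq_map_poly => b.
  by rewrite /= cj_emb_base.
pose E := (E' * e0)%N.
have E0 : (0 < E)%N by rewrite muln_gt0 E'0.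
have wE a : w (cj_base cj a) = E%:Z * v a.
  by rewrite -cj_emb_base wE' (v0e a) mulrA.
pose g s := cj_aut s (cj_emb cj u).
pose b s := `[< vge w (g s - 1) 1 >].
pose c := (\sum_s (b s : nat))%N.
have c0 : (0 < c)%N.
  have [s sid] := cj_aut_id cj.
  suff bs : b s by rewrite /c (bigD1 s) //= bs.
  apply/asboolP; rewrite /g sid -(rmorph1 (cj_emb cj)) -rmorphB.
  case: u1 => [->|u1]; first by left; rewrite rmorph0.
  by right; rewrite wE'; apply: (le_trans u1); rewrite ler_peMl //; apply: le_trans u1.
have near : vge w (cj_base cj (T u) - c%:R) 1.
  rewrite cj_traceE natr_sum -sumrB; apply: vge_sum => // s _.
  have [/asboolP //|nb] := boolP (b s).
  rewrite subr0; have [v' [e [r [v'e r0 re gE]]]] := conj_valuation s pw E0 wE.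
  have ne : v' != v0.
    apply: contraNneq nb => E1; apply/asboolP.
    rewrite /g -(rmorph1 (cj_aut s)) -(rmorph1 (cj_emb cj)) -!rmorphB.
    case: u1 => [->|u1]; first by left; rewrite !rmorph0.
    right; rewrite gE E1; apply: (le_trans u1).
    by rewrite ler_peMl //; apply: le_trans u1.
  case: (u0 v' _ ne) => [|u00|h]; first by exists e.
    by left; rewrite u00 !rmorph0.
  by right; rewrite gE; apply: (le_trans h); rewrite ler_peMl //; apply: le_trans h.
have wc : w (cj_base cj c%:R) = 0 by rewrite wE vn // mulr0.
have c1 : cj_base cj c%:R != 0.
  by rewrite fmorph_eq0; have /pcharf0P -> := ch; rewrite -lt0n.
have [] := @pvalD_eq _ _ pw _ (cj_base cj (T u) - c%:R) c1.
  by rewrite wc add0r.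
rewrite rmorph_nat addrC subrK fmorph_eq0 => Tu0.
by rewrite -(rmorph_nat (cj_base cj)) wc wE => /eqP; rewrite mulf_eq0 => /orP[/eqP|/eqP]; [lia|].
Qed.

End Trace.

(** * Dual bases with bounded denominators *)

Lemma above_bounded (F : fieldType) (L : fieldExtType F) (v : valuation F) (a : L) :
  exists C : nat, forall v' e, lies_above (in_alg L) v v' e ->
    vge v' a (- (C%:Z * e%:Z)).
Proof.
have pv := valuation_preval v; have [t t0 vt] := val_normalized v.
have [p p0 pa] := algebraicOver_ext a.
have [r rP] := seq_bound (p : seq F) (fun c => - v c).
pose q := (t ^+ r) *: p.
have tr0 : t ^+ r != 0 by rewrite expf_neq0.
have vtr : v (t ^+ r) = r by rewrite pvalX // vt mulr1.
have qi i : vge v q`_i 0.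
  rewrite coefZ; have [->|pi0] := eqVneq p`_i 0; first by left; rewrite mulr0.
  right; rewrite pvalM // vtr.
  have /rP : p`_i \in (p : seq F); last by lia.
  apply: mem_nth; rewrite ltnNge; apply: contra pi0 => h; by rewrite nth_default.
have q0 : q != 0 by rewrite scaler_eq0 negb_or tr0.
have vq : 0 <= v (lead_coef q).
  have [/eqP|//] := qi (size q).-1.
  by rewrite -lead_coefE lead_coef_eq0 (negPf q0).
exists `|v (lead_coef q)|%N => v' e [e0 v'e].
have pv' := valuation_preval v'.
have := @vge_root _ _ pv' (map_poly (in_alg L) q) a.
rewrite map_poly_eq0 lead_coef_map v'e; move=> H.
apply: (vge_le _ (H _ _ _)) => //; first by lia.
  move=> i; rewrite coef_map; case: (qi i) => [->|h]; first by left; rewrite /= scale0r.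
  by right; rewrite v'e mulr_ge0.
by rewrite /q linearZ /= rootE hornerZ (eqP pa) mulr0.
Qed.

(** Column j of the matrix has a single nonzero entry. *)
Lemma det_replace_row (R : comNzRingType) (n : nat) (r : 'rV[R]_n) (j : 'I_n) :
  \det (\matrix_(i, l) (if i == j then r 0 l else (i == l)%:R)) = r 0 j.
Proof.
rewrite (expand_det_col _ j) (bigD1 j) //= big1 ?addr0; last first.
  by move=> i ne; rewrite mxE (negPf ne) mul0r.
rewrite mxE eqxx /cofactor -signr_odd addnn odd_double expr0 mul1r.
suff -> : row' j (col' j (\matrix_(i, l) (if i == j then r 0 l else (i == l)%:R))) = 1%:M.
  by rewrite det1 mulr1.
apply/matrixP => i l; rewrite !mxE.
by rewrite eq_sym (negPf (neq_lift _ _)) (inj_eq lift_inj).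
Qed.

Section DualBasis.
Variables (F : fieldType) (L : fieldExtType F) (cj : galois_data L).
Hypothesis ch : [pchar F] =i pred0.
Local Notation T := (cj_trace cj).
Variables (v : valuation F) (v0 : valuation L) (e0 : nat).
Hypothesis vn : forall n, (0 < n)%N -> v n%:R = 0.
Hypothesis v0e : lies_above (in_alg L) v v0 e0.

Let n : nat := \dim {:L}.
Let integral (a : L) := forall v', above (in_alg L) v v' -> vge v' a 0.
Let Gram (x : 'I_n -> L) := \matrix_(i, j) T (x i * x j).

Lemma trace_integral a : integral a -> vge v (T a) 0.
Proof.
move=> ia; apply: trace_vge => v' e v'e.
by apply: vge_le (ia _ (ex_intro _ e v'e)); case: v'e; lia.
Qed.

(** A basis multiplied by a high power of t is integral, and its Gram matrix is
    invertible because the trace form is nondegenerate: Tr(a / a) is not 0. *)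
Lemma integral_frame : exists x : 'I_n -> L,
  (forall i, integral (x i)) /\ \det (Gram x) != 0.
Proof.
have [t t0 vt] := val_normalized v; have pv := valuation_preval v.
pose b := vbasis {:L}.
have ex_C (i : 'I_n) := above_bounded v b`_i.
have [C CP] := choice ex_C.
pose N := \max_i C i.
have tN0 : t ^+ N != 0 by rewrite expf_neq0.
exists (fun i => t ^+ N *: b`_i); split.
  move=> i v' [e v'e]; have pv' := valuation_preval v'.
  have := CP i v' e v'e; case: v'e => e_0 v'e bi.
  have le : (C i <= N)%N by apply: leq_bigmax.
  rewrite -mulr_algl; apply: (@vge_le _ _ _ (N%:Z * e%:Z + - ((C i)%:Z * e%:Z))).
    by nia.
  apply: vgeM => //; right; rewrite v'e pvalX // vt; lia.
apply/det0P => -[u u0 uG]; case/negP: u0; apply/eqP.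
pose a := \sum_i u 0 i *: b`_i.
have aT (j : 'I_n) : T (a * b`_j) = 0.
  have E : (u *m Gram (fun i => t ^+ N *: b`_i)) 0 j = t ^+ N * t ^+ N * T (a * b`_j).
    rewrite mxE /a mulr_suml trace_sum mulr_sumr; apply: eq_bigr => i _.
    by rewrite mxE -!scalerAl -!scalerAr !traceZ; ring.
  move: E; rewrite uG mxE => /esym/eqP.
  by rewrite !mulf_eq0 (negPf tN0) /= => /eqP.
have aT' z : T (a * z) = 0.
  rewrite (coord_vbasis (memvf z)) mulr_sumr trace_sum big1 // => i _.
  by rewrite -scalerAr traceZ aT mulr0.
have a0 : a = 0.
  apply/eqP; apply: contraT => an0.
  by have := aT' a^-1; rewrite mulfV // => /eqP; rewrite (negPf (trace1_neq0 cj ch)).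
apply/rowP => i; rewrite mxE.
have /freeP : free b by apply: (basis_free (vbasisP _)).
exact.
Qed.

Lemma dual_frame (x : 'I_n -> L) : \det (Gram x) != 0 ->
  exists y : 'I_n -> L, (forall i j, T (x i * y j) = (i == j)%:R) /\
    forall a, a = \sum_j T (a * y j) *: x j.
Proof.
move=> G0; pose H := invmx (Gram x).
have GH : Gram x *m H = 1%:M by rewrite mulmxV // unitmxE unitfE.
pose y j := \sum_l H l j *: x l.
have xy i j : T (x i * y j) = (i == j)%:R.
  have := congr1 (fun M : 'M[F]_n => M i j) GH; rewrite !mxE => <-.
  rewrite /y mulr_sumr trace_sum; apply: eq_bigr => l _.
  by rewrite -scalerAr traceZ mxE mulrC.
exists y; split=> // a.
pose X := [tuple x i | i < n].
have Xi (i : 'I_n) : X`_i = x i by rewrite -tnth_nth tnth_mktuple.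
have Ty (k : 'I_n -> F) (j : 'I_n) : T ((\sum_(i < n) k i *: X`_i) * y j) = k j.
  rewrite mulr_suml trace_sum (bigD1 j) //= big1 ?addr0.
    by rewrite -scalerAl traceZ Xi xy eqxx mulr1.
  by move=> i ne; rewrite -scalerAl traceZ Xi xy (negPf ne) mulr0.
have fX : free X.
  by apply/freeP => k k0 i; rewrite -(Ty k i) k0 mul0r trace0.
have bX : basis_of {:L} X by rewrite basisEfree fX subvf size_tuple leqnn.
rewrite {1}(coord_basis bX (memvf a)); apply: eq_bigr => i _.
by rewrite {2}(coord_basis bX (memvf a)) Ty Xi.
Qed.

(** The change of basis is the identity except in row j, where it holds the
    coordinates of w. *)
Lemma exchange (x y : 'I_n -> L) (w : L) (j : 'I_n) :
  (forall a, a = \sum_l T (a * y l) *: x l) ->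
  \det (Gram (fun i => if i == j then w else x i))
    = T (w * y j) ^+ 2 * \det (Gram x).
Proof.
move=> exp; pose r : 'rV[F]_n := \row_l T (w * y l).
pose M := \matrix_(i, l) (if i == j then r 0 l else (i == l)%:R).
have xM i : (if i == j then w else x i) = \sum_l M i l *: x l.
  case: eqP => [->|/eqP ne].
    by rewrite {1}(exp w); apply: eq_bigr => l _; rewrite !mxE eqxx.
  rewrite (bigD1 i) //= big1 ?addr0; first by rewrite mxE (negPf ne) eqxx scale1r.
  by move=> l nl; rewrite mxE (negPf ne) eq_sym (negPf nl) scale0r.
have -> : Gram (fun i => if i == j then w else x i) = M *m Gram x *m M^T.
  apply/matrixP => i k; rewrite !mxE !xM mulr_suml trace_sum.
  under [RHS]eq_bigr do rewrite !mxE mulr_suml.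
  rewrite exchange_big /=; apply: eq_bigr => l _.
  rewrite mulr_sumr trace_sum; apply: eq_bigr => h _.
  by rewrite -scalerAl -scalerAr !traceZ !mxE; ring.
by rewrite !det_mulmx det_tr det_replace_row mxE; ring.
Qed.

(** Among the integral bases, the value of the Gram determinant is a natural
    number. If some dual vector y_j had a pole of order at least e0 at v0, then
    w = u / (t y_j) would be integral for a suitable approximate idempotent u,
    while Tr(w y_j) = Tr(u) / t has value -1. Exchanging x_j for w would lower
    the value of the determinant by 2. *)
Lemma dual_basis : exists x y : 'I_n -> L,
  [/\ forall i j, T (x i * y j) = (i == j)%:R,
      forall a, a = \sum_j T (a * y j) *: x j,
      forall j, vge v0 (x j) 0 &
      forall j, vge v0 (y j) (1 - e0%:Z)].
Proof.
have [t t0 vt] := val_normalized v; have pv := valuation_preval v.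
have p0 := valuation_preval v0; have [e00 v0E] := v0e.
have v0ab : above (in_alg L) v v0 by exists e0.
have [x0 [ix0 G0]] := integral_frame.
move: {2}`|v (\det (Gram x0))|.+1 (ltnSn `|v (\det (Gram x0))|) => N.
elim: N => // N IH in x0 ix0 G0 *; rename x0 into x => lt.
have [y [xy exp]] := dual_frame G0.
have [good|] := pselect (forall j, vge v0 (y j) (1 - e0%:Z)).
  by exists x, y; split=> // j; apply: ix0.
move=> /existsNP[j /not_orP[/eqP yj0 /negP]]; rewrite -ltNge => yj.
have [C CP] := above_bounded v (y j)^-1.
have [u [u1 u0]] := above_idempotent v v0 C.+1.
have [un0 v0u] := unit_near1 p0 u1.
pose w := u / (t%:A * y j).
have tA0 : t%:A != 0 :> L by rewrite scaler_eq0 negb_or t0 oner_neq0.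
have iw : integral w.
  move=> v' [e v'e]; have pv' := valuation_preval v'.
  have v'tA : v' (t%:A)^-1 = - e%:Z.
    by rewrite pvalV //; case: v'e => _ /(_ t) /=; rewrite vt mulr1 => ->.
  rewrite /w invfM mulrCA.
  have [E|ne] := eqVneq v' v0.
    right; rewrite E in v'e v'tA *.
    have ee : e%:Z = e0%:Z.
      by have [_ /(_ t)] := v'e; rewrite v0E vt !mulr1.
    by rewrite !pvalM ?mulf_neq0 ?invr_eq0 // v'tA v0u pvalV //; lia.
  have := u0 _ _ ne v'e; have := CP _ _ v'e => y1 u1'.
  apply: (@vge_le _ _ _ (- e%:Z + (C.+1%:Z * e%:Z + - (C%:Z * e%:Z)))); first by lia.
  by apply: vgeM => //; [right; rewrite v'tA|apply: vgeM].
have wy : w * y j = t^-1 *: u.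
  have tV : (t^-1)%:A = (t%:A)^-1 :> L by exact: (fmorphV (in_alg L)).
  by rewrite -mulr_algl tV /w; field; rewrite yj0 tA0.
have [Tu0 vTu] : T u != 0 /\ v (T u) = 0.
  apply: (trace_idempotent cj ch vn v0ab u1) => v' [e v'e] ne.
  apply: vge_le (u0 _ _ ne v'e); case: v'e; nia.
have Twy0 : T (w * y j) != 0 by rewrite wy traceZ mulf_neq0 ?invr_eq0.
have vTwy : v (T (w * y j)) = -1.
  by rewrite wy traceZ pvalM ?invr_eq0 // pvalV // vt vTu addr0.
pose x' i := if i == j then w else x i.
have ix' i : integral (x' i) by rewrite /x'; case: eqP.
have G'0 : \det (Gram x') != 0 by rewrite (exchange w j exp) mulf_neq0 ?expf_neq0.
apply: (IH x' ix' G'0).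
have vG' : vge v (\det (Gram x')) 0.
  rewrite /determinant; apply: vge_sum => // s _; apply: vgeM0 => //.
    by right; rewrite pvalX // pvalN // pval1 // mulr0.
  apply: vge_prod => // i _; rewrite mxE; apply: trace_integral => v' v'ab.
  by apply: vgeM0; [apply: valuation_preval|apply: ix'|apply: ix'].
have vE : v (\det (Gram x')) = -2 + v (\det (Gram x)).
  by rewrite (exchange w j exp) pvalM ?expf_neq0 // pvalX // vTwy.
by case: vG' => [/eqP|]; [rewrite (negPf G'0)|rewrite vE; lia].
Qed.

End DualBasis.

Section Reconstruction.
Variables (F : fieldType) (L : fieldExtType F) (cj : galois_data L).
Hypothesis ch : [pchar F] =i pred0.
Local Notation T := (cj_trace cj).
Variables (n : nat) (x y : 'I_n -> L).
Hypothesis xy : forall i j, T (x i * y j) = (i == j)%:R.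
Hypothesis expand : forall a, a = \sum_j T (a * y j) *: x j.

(** * Recovering an element from traces *)

Lemma expand_dual a : a = \sum_j T (a * x j) *: y j.
Proof.
apply/eqP; rewrite -subr_eq0; apply: contraT; set d := a - _ => d0.
have dx i : T (d * x i) = 0.
  rewrite /d mulrDl traceD mulNr -[- (_ * _)]scaleN1r traceZ mulN1r mulr_suml.
  rewrite trace_sum (bigD1 i) //= big1 ?addr0; last first.
    by move=> j ne; rewrite -scalerAl traceZ [y j * _]mulrC xy eq_sym (negPf ne) mulr0.
  by rewrite -scalerAl traceZ [y i * _]mulrC xy eqxx mulr1 subrr.
have dz z : T (d * z) = 0.
  rewrite (expand z) mulr_sumr trace_sum big1 // => i _.
  by rewrite -scalerAr traceZ dx mulr0.
by have := dz d^-1; rewrite mulfV // => /eqP; rewrite (negPf (trace1_neq0 cj ch)).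
Qed.

(** Multiplication by a has transposed matrices in the two dual bases, so
    multiplying the sum by s(a) or by t(a) gives the same result. *)
Lemma dual_orthogonality (M : fieldType) (s t : {rmorphism L -> M}) :
  (forall a, s a%:A = t a%:A) -> (exists a, s a != t a) ->
  \sum_j s (y j) * t (x j) = 0.
Proof.
move=> st [a ne].
have E : s a * \sum_j s (y j) * t (x j) = t a * \sum_j s (y j) * t (x j).
  have sZ c z : s (c *: z) = t c%:A * s z by rewrite -(mulr_algl c z) rmorphM st.
  have tZ c z : t (c *: z) = t c%:A * t z by rewrite -(mulr_algl c z) rmorphM.
  rewrite !mulr_sumr.
  transitivity (\sum_j \sum_i t (T (a * y j * x i))%:A * s (y i) * t (x j)).
    apply: eq_bigr => j _; rewrite mulrA -rmorphM {1}(expand_dual (a * y j)).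
    by rewrite rmorph_sum mulr_suml; apply: eq_bigr => i _; rewrite sZ.
  rewrite exchange_big; apply: eq_bigr => i _ /=.
  rewrite mulrCA -rmorphM (expand (a * x i)) rmorph_sum mulr_sumr.
  apply: eq_bigr => j _; rewrite [t (_ *: x j)]tZ (_ : a * y j * x i = a * x i * y j); last by ring.
  by ring.
apply/eqP; apply: contraT => nz; case/eqP: ne.
by move/(mulIf nz): E.
Qed.

(** Expand 1 in the basis and write its coordinates as sums over conjugates. By
    orthogonality only the c conjugates that fix L contribute. *)
Lemma dual_trace_const : exists2 c : nat, (0 < c)%N & c%:R * \sum_j y j * x j = 1.
Proof.
pose fix_ s := `[< forall a, cj_aut s (cj_emb cj a) = cj_emb cj a >].
pose c := (\sum_s (fix_ s : nat))%N.
suff E : c%:R * \sum_j y j * x j = 1.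
  exists c => //; rewrite lt0n; apply: contra_eq_neq E => ->.
  by rewrite mul0r eq_sym oner_neq0.
apply: (fmorph_inj (cj_emb cj)); rewrite {2}(expand 1) rmorphM rmorph_nat !rmorph_sum.
under [RHS]eq_bigr => j _ do
  rewrite -mulr_algl rmorphM cj_emb_base cj_traceE mulr_suml.
rewrite exchange_big mulr_suml; apply: eq_bigr => s _ /=.
have [/asboolP fs|/asboolP nf] := boolP (fix_ s).
  rewrite mul1r; apply: eq_bigr => j _.
  by rewrite fs mul1r rmorphM.
rewrite mul0r; under eq_bigr do rewrite mul1r.
have /= -> // := @dual_orthogonality _ (cj_aut s \o cj_emb cj) (cj_emb cj).
  by move=> a; rewrite /= cj_emb_base [LHS]cj_aut_base.
by move/existsNP: nf => [a /eqP ?]; exists a.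
Qed.

(** Expand the traces as sums over conjugates of M / D. By orthogonality a
    conjugate contributes only if it fixes g(L); as it fixes D too, it then fixes
    M, and its contribution is b up to the constant of dual_trace_const. *)
Lemma reconstruction (D : fieldType) (M : fieldExtType D) (cjM : galois_data M)
    (h : {rmorphism F -> D}) (g : {rmorphism L -> M}) :
  (forall a, g a%:A = (h a)%:A) ->
  (forall S : {pred M}, divring_closed S -> (forall a : D, a%:A \in S) ->
     (forall b, g b \in S) -> forall d, d \in S) ->
  exists c c' : nat, [/\ (0 < c)%N, (0 < c')%N & forall b,
    c'%:R * b = c%:R * \sum_j cj_trace cjM (b * g (y j)) *: g (x j)].
Proof.
move=> gh gen; have [c c0 cE] := dual_trace_const.
pose f := cj_emb cjM.
pose fix_ s := `[< forall a, cj_aut s (f a) = f a >].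
have [c' c'E] : exists c', c' = (\sum_s (fix_ s : nat))%N by eexists.
exists c, c'; split=> //.
  have [s sid] := cj_aut_id cjM.
  have fs : fix_ s by apply/asboolP.
  by rewrite c'E (bigD1 s) //= fs.
move=> b; apply: (fmorph_inj f); rewrite !rmorphM !rmorph_nat rmorph_sum.
under eq_bigr => j _ do
  rewrite -mulr_algl rmorphM cj_emb_base cj_traceE mulr_suml.
rewrite exchange_big c'E natr_sum mulr_suml mulr_sumr; apply: eq_bigr => s _ /=.
under eq_bigr => j _ do rewrite !rmorphM -mulrA.
rewrite -mulr_sumr -/f.
have [/asboolP fs|/asboolP nf] := boolP (fix_ s).
  have gs1 : c%:R * f (g (\sum_j y j * x j)) = 1.
    by rewrite -(rmorph_nat f) -(rmorph_nat g) -!rmorphM cE !rmorph1.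
  rewrite mul1r fs mulrCA -[LHS]mulr1 -[in LHS]gs1; congr (_ * (_ * _)).
  by rewrite !rmorph_sum; apply: eq_bigr => j _; rewrite fs !rmorphM.
rewrite mul0r.
have /= -> := @dual_orthogonality _ (cj_aut s \o f \o g) (f \o g); first by rewrite !mulr0.
  by move=> a /=; rewrite gh /f cj_emb_base [LHS]cj_aut_base.
apply: contrapT => /forallNP same; apply: nf => a.
pose S : {pred M} := fun d => cj_aut s (f d) == f d.
apply/eqP; apply: (gen S).
- split; rewrite ?unfold_in /S ?rmorph1 ?eqxx //.
  + by move=> u w; rewrite !unfold_in !rmorphB => /eqP-> /eqP->.
  + by move=> u w; rewrite !unfold_in !fmorph_div => /eqP-> /eqP->.
- by move=> d; rewrite unfold_in /f cj_emb_base; apply/eqP/cj_aut_base.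
- by move=> d; rewrite unfold_in; apply/eqP; have /negP/negPn/eqP := same d.
Qed.

End Reconstruction.

(** * Function fields of one variable and their residue fields *)

Section SimpleExtension.
Variables (k M : fieldType) (c : {rmorphism k -> M}) (b : M).

(** The subfield k(b) of M. *)
Definition simple_ext : {pred M} := fun z => `[< exists p q : {poly k},
  (map_poly c q).[b] != 0 /\ z = (map_poly c p).[b] / (map_poly c q).[b] >].

Lemma simple_extP z : reflect (exists p q : {poly k},
  (map_poly c q).[b] != 0 /\ z = (map_poly c p).[b] / (map_poly c q).[b])
  (z \in simple_ext).
Proof. exact: asboolP. Qed.

Lemma simple_ext_closed : divring_closed simple_ext.
Proof.
split.
- apply/simple_extP; exists 1, 1; rewrite rmorph1 hornerC divr1.
  by split=> //; apply: oner_neq0.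
- move=> _ _ /simple_extP[p [q [q0 ->]]] /simple_extP[p' [q' [q'0 ->]]].
  apply/simple_extP; exists (p * q' - p' * q), (q * q').
  rewrite rmorphB !rmorphM /= hornerD hornerN !hornerM mulf_neq0 //; split=> //.
  by field; rewrite q0 q'0.
- move=> _ _ /simple_extP[p [q [q0 ->]]] /simple_extP[p' [q' [q'0 ->]]].
  apply/simple_extP; have [p'0|p'0] := eqVneq (map_poly c p').[b] 0.
    exists 0, 1; rewrite p'0 rmorph1 rmorph0 hornerC horner0 !mul0r invr0 mulr0.
    by split=> //; apply: oner_neq0.
  exists (p * q'), (q * p'); rewrite !rmorphM /= !hornerM mulf_neq0 //; split=> //.
  by field; rewrite q0 q'0 p'0.
Qed.

HB.instance Definition _ := GRing.isDivringClosed.Build M simple_ext simple_ext_closed.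

Record simple_ext_type := SimpleExt {
  simple_ext_val : M; _ : simple_ext_val \in simple_ext }.

HB.instance Definition _ := [isSub for simple_ext_val].
HB.instance Definition _ := [Choice of simple_ext_type by <:].
HB.instance Definition _ := [SubChoice_isSubIntegralDomain of simple_ext_type by <:].
HB.instance Definition _ := [SubIntegralDomain_isSubField of simple_ext_type by <:].

End SimpleExtension.

Lemma simple_subfield (k M : fieldType) (c : {rmorphism k -> M}) (b : M) :
  exists (E : fieldType) (e : {rmorphism E -> M}),
    [/\ forall a, exists z, e z = c a, exists z, e z = b &
    forall z, exists p q : {poly k},
      (map_poly c q).[b] != 0 /\ e z = (map_poly c p).[b] / (map_poly c q).[b]].
Proof.
pose e : {rmorphism simple_ext_type c b -> M} := val.
have polyI p : exists z, e z = (map_poly c p).[b].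
  have Sp : (map_poly c p).[b] \in simple_ext c b.
    apply/simple_extP; exists p, 1; rewrite rmorph1 hornerC divr1.
    by split=> //; apply: oner_neq0.
  by exists (SimpleExt Sp).
exists (simple_ext_type c b), e; split.
- by move=> a; have [z zE] := polyI a%:P; exists z; rewrite zE map_polyC hornerC.
- by have [z zE] := polyI 'X; exists z; rewrite zE map_polyX hornerX.
- by move=> z; apply/simple_extP; apply: valP.
Qed.

Lemma algebraic_image (E M : fieldType) (e : {rmorphism E -> M}) (a : M) :
  (exists z, e z = a) -> algebraicOver e a.
Proof. by move=> [z <-]; apply: algebraic_id. Qed.

Lemma fraction_tofrac (R : idomainType) (f : {fraction R}) :
  exists n d : R, d != 0 /\ f = tofrac n / tofrac d.
Proof.
elim/quotW: f => r; exists (\n_r), (\d_r); split; first exact: denom_ratioP.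
apply: (canRL (mulfK _)); first by rewrite tofrac_eq0 denom_ratioP.
unlock FracField.tofrac; rewrite -[LHS]FracField.pi_mul.
apply/eqmodP; rewrite /= FracField.equivfE /FracField.mulf.
rewrite !numden_Ratio ?mulf_neq0 ?oner_neq0 ?denom_ratioP //.
by rewrite !mulr1 mulrC eqxx.
Qed.

Lemma algebraic_root (E M : fieldType) (e : {rmorphism E -> M}) (p : {poly M}) z :
  p != 0 -> root p z -> (forall i, algebraicOver e p`_i) -> algebraicOver e z.
Proof.
move=> p0 pz palg; have lc0 : lead_coef p != 0 by rewrite lead_coef_eq0.
apply/integral_algebraic.
apply: (@integral_root_monic _ _ _ _ ((lead_coef p)^-1 *: p)).
- by rewrite monicE lead_coefZ mulVf.
- by rewrite rootE hornerZ (eqP pz) mulr0.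
- move=> a /(nthP 0)[i _ <-]; rewrite coefZ mulrC; apply/integral_algebraic.
  by apply: algebraic_div => //; rewrite lead_coefE. 
Qed.

Lemma algebraic_horner (k E M : fieldType) (c : {rmorphism k -> M})
    (e : {rmorphism E -> M}) (p : {poly k}) b :
  (forall a, algebraicOver e (c a)) -> algebraicOver e b ->
  algebraicOver e (map_poly c p).[b].
Proof.
move=> ca eb; elim/poly_ind: p => [|p a IH].
  by rewrite rmorph0 horner0; apply: algebraic0.
rewrite rmorphD rmorphM /= map_polyX map_polyC hornerMXaddC.
apply: algebraic_add; [exact: algebraic_mul|exact: ca]. 
Qed.

Lemma algebraic_trans (E E' M : fieldType) (e : {rmorphism E -> M})
    (e' : {rmorphism E' -> M}) z :
  (forall a, algebraicOver e (e' a)) -> algebraicOver e' z -> algebraicOver e z.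
Proof.
move=> ee' [p p0 pz]; apply: algebraic_root pz _; first by rewrite map_poly_eq0.
by move=> i; rewrite coef_map; apply: ee'. 
Qed.

(** M is algebraic over k(x). The formulation by subfields E makes this notion
    transitive without reference to a presentation of k(x): it says that a
    relatively algebraically closed subfield containing k and x is all of M. *)
Definition algebraic_generator (k M : fieldType) (c : {rmorphism k -> M}) (x : M) :=
  forall (E : fieldType) (e : {rmorphism E -> M}),
    (forall a, algebraicOver e (c a)) -> algebraicOver e x ->
    forall z, algebraicOver e z.

Lemma function_field_generator (k : fieldType) (K : fieldExtType {fraction {poly k}}) :
  algebraic_generator (ff_const K) (ff_var K).
Proof.
move=> E e ec ex z; apply: algebraic_trans (algebraicOver_ext z) => f.
have tf (p : {poly k}) : algebraicOver e (in_alg K (tofrac p)).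
  elim/poly_ind: p => [|p a IH]; first by rewrite !rmorph0; apply: algebraic0.
  rewrite rmorphD rmorphM rmorphD rmorphM; apply: algebraic_add; last exact: ec.
  exact: algebraic_mul.
have [n [d [_ ->]]] := fraction_tofrac f.
by rewrite fmorph_div; apply: algebraic_div; apply: tf.
Qed.

Lemma algebraic_generator_image (k M N : fieldType) (c : {rmorphism k -> M}) (x : M)
    (g : {rmorphism M -> N}) : algebraic_generator c x ->
  forall (E : fieldType) (e : {rmorphism E -> N}),
    (forall a, algebraicOver e (g (c a))) -> algebraicOver e (g x) ->
    forall z, algebraicOver e (g z).
Proof.
move=> gen E e ec ex f; have [e1 [e1' [e1c e1x e1E]]] := simple_subfield c x.
have [||p p0 pf] := gen _ e1' _ _ f.
- by move=> a; apply: algebraic_image.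
- exact: algebraic_image.
apply: (@algebraic_trans _ _ _ e (g \o e1')).
  move=> a; have [p1 [q1 [_]]] := e1E a; rewrite /= => ->.
  rewrite fmorph_div -!horner_map -!map_poly_comp.
  by apply: algebraic_div; apply: (@algebraic_horner _ _ _ (g \o c)).
exists p => //; rewrite map_poly_comp rootE /=.
by rewrite horner_map (eqP pf) rmorph0.
Qed.

Lemma algebraic_generator_ext (k M : fieldType) (c : {rmorphism k -> M}) (x : M)
    (L : fieldExtType M) : algebraic_generator c x ->
  algebraic_generator (in_alg L \o c) (in_alg L x).
Proof.
move=> gen E e ec ex z; apply: algebraic_trans (algebraicOver_ext z).
exact: (algebraic_generator_image gen).
Qed.

(** The exchange property of transcendence degree 1. An equation for b over k(x)
    is, after clearing denominators, a polynomial relation between x and b over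
    k; as b is transcendental, it does not become trivial when read as an
    equation for x over k(b). *)
Lemma algebraic_generator_exchange (k M : fieldType) (c : {rmorphism k -> M}) (x b : M) :
  algebraic_generator c x ->
  (forall p : {poly k}, p != 0 -> (map_poly c p).[b] != 0) ->
  algebraic_generator c b.
Proof.
move=> gen btr E e ec eb; apply: (gen) => //.
have [E1 [e1 [e1c e1x e1E]]] := simple_subfield c x.
have [||p p0 pb] := gen _ e1 _ _ b.
- by move=> a; apply: algebraic_image.
- exact: algebraic_image.
have [n nE] := choice e1E; have [d dE] := choice nE.
pose N := size p.
(* The numerators of the coefficients of p over a common denominator. *)
pose r (i : nat) : {poly k} :=
  n p`_i * \prod_(j < N | (j : nat) != i) d p`_j.
pose Den := \prod_(j < N) (map_poly c (d p`_j)).[x].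
have Den0 : Den != 0 by apply/prodf_neq0 => j _; have [] := dE p`_j.
have rE (i : 'I_N) : (map_poly c (r i)).[x] = e1 p`_i * Den.
  rewrite /r rmorphM hornerM /= rmorph_prod horner_prod /Den [in RHS](bigD1 i) //=.
  by have [d0 ->] := dE p`_i; rewrite mulrA divfK.
pose B := \max_(i < N) size (r i).
pose Q j : {poly k} := \poly_(i < N) (r i)`_j.
pose q := \poly_(j < B) (map_poly c (Q j)).[b].
apply: (@algebraic_root _ _ e q).
- have [i ri0] : exists i : 'I_N, r i != 0.
    have lt : (N.-1 < N)%N by rewrite prednK // size_poly_gt0.
    exists (Ordinal lt); apply: contra_neq Den0 => r0; have := rE (Ordinal lt).
    rewrite r0 rmorph0 horner0 => /esym/eqP; rewrite mulf_eq0 fmorph_eq0 /=.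
    by rewrite -lead_coefE lead_coef_eq0 (negPf p0) => /eqP.
  pose j := (size (r i)).-1.
  have jB : (j < B)%N.
    by rewrite /j prednK ?size_poly_gt0 //; apply: (leq_bigmax i).
  apply: contraNneq (_ : (map_poly c (Q j)).[b] != 0) => [q0|].
    by have := coef_poly B (fun j => (map_poly c (Q j)).[b]) j; rewrite -/q q0 coef0 jB => <-.
  apply: btr; apply: contraNneq ri0 => Q0.
  have := coef_poly N (fun i => (r i)`_j) i; rewrite -/(Q j) Q0 coef0 ltn_ord.
  by move/esym/eqP; rewrite -lead_coefE lead_coef_eq0.
- rewrite rootE horner_poly.
  have -> : \sum_(j < B) (map_poly c (Q j)).[b] * x ^+ j
          = \sum_(i < N) (map_poly c (r i)).[x] * b ^+ i.
    transitivity (\sum_(j < B) \sum_(i < N) c (r i)`_j * b ^+ i * x ^+ j).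
      apply: eq_bigr => j _; rewrite -mulr_suml; congr (_ * _).
      rewrite (@horner_coef_wide _ N) ?size_map_poly ?size_poly //.
      by apply: eq_bigr => i _; rewrite coef_map coef_poly ltn_ord.
    rewrite exchange_big; apply: eq_bigr => i _ /=.
    rewrite (@horner_coef_wide _ B) ?size_map_poly //; last first.
      exact: (leq_bigmax i).
    rewrite mulr_suml; apply: eq_bigr => j _.
    by rewrite coef_map mulrAC.
  under eq_bigr do rewrite rE mulrAC.
  rewrite -mulr_suml; move: pb; rewrite rootE horner_coef size_map_poly.
  under eq_bigr do rewrite coef_map.
  by move/eqP->; rewrite mul0r.
- by move=> j; rewrite coef_poly; case: ifP => _; [apply: algebraic_horner|apply: algebraic0].
Qed.

(** If no polynomial in b were small, v would be trivial on k(b), over which M is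
    algebraic by exchange; then v would be trivial on M. *)
Lemma residue_algebraic (k M : fieldType) (c : {rmorphism k -> M}) (x : M)
    (v : valuation M) : algebraic_generator c x -> (forall a, v (c a) = 0) ->
  forall b, vge v b 0 ->
    exists h : {poly k}, h != 0 /\ vge v (map_poly c h).[b] 1.
Proof.
move=> gen vc b b0; apply: contrapT => H; have pv := valuation_preval v.
have h0 (h : {poly k}) : h != 0 ->
    (map_poly c h).[b] != 0 /\ v (map_poly c h).[b] = 0.
  move=> hn; have : vge v (map_poly c h).[b] 0.
    by apply: vge_horner => // i; rewrite coef_map; right; rewrite vc.
  have : ~ vge v (map_poly c h).[b] 1 by move=> h1; apply: H; exists h.
  move=> /not_orP[/eqP nz /negP lt] [z|ge]; first by rewrite z eqxx in nz.
  by split=> //; lia.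
have gb := algebraic_generator_exchange gen (fun p p0 => proj1 (h0 p p0)).
have [E [e [ec eb eE]]] := simple_subfield c b.
have ve z : v (e z) = 0.
  have [p [q [q0 ->]]] := eE z.
  have [->|p0] := eqVneq p 0; first by rewrite rmorph0 horner0 mul0r pval0.
  have qn : q != 0 by apply: contraNneq q0 => ->; rewrite rmorph0 horner0.
  have [pb vp] := h0 _ p0; have [qb vq] := h0 _ qn.
  by rewrite pvalM ?invr_eq0 // pvalV // vp vq.
have [t _] := val_normalized v; rewrite (pval_algebraic0 pv ve) //.
by apply: gb => [a|]; apply: algebraic_image.
Qed.

Section ResidueField.
Variables (F : fieldType) (v : valuation F).
Let pv := valuation_preval v.

(** The residue field is carried by canonical representatives of the residue
    classes, chosen as a function of the class, which is a set. *)
Definition residue_repr (a : F) : F :=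
  xget 0 [set b | vge v b 0 /\ vge v (a - b) 1].

Lemma residue_reprP a : vge v a 0 ->
  vge v (residue_repr a) 0 /\ vge v (a - residue_repr a) 1.
Proof.
move=> a0; rewrite /residue_repr; case: xgetP => [b _ //|/(_ a)[]].
by split=> //; left; rewrite subrr.
Qed.

Lemma residue_repr_eq a b : vge v (a - b) 1 -> residue_repr a = residue_repr b.
Proof.
move=> ab; rewrite /residue_repr; congr xget; apply/seteqP; split=> d /= [d0 h].
- split=> //; have -> : b - d = (a - d) - (a - b) by ring.
  exact: vgeB.
- split=> //; have -> : a - d = (a - b) + (b - d) by ring.
  exact: vgeD.
Qed.

Record residue := Residue {
  residue_val : F;
  _ : `[< vge v residue_val 0 >] && (residue_repr residue_val == residue_val) }.

HB.instance Definition _ := [isSub for residue_val].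
HB.instance Definition _ := [Choice of residue by <:].

Fact residue_sub a : vge v a 0 -> `[< vge v (residue_repr a) 0 >] &&
  (residue_repr (residue_repr a) == residue_repr a).
Proof.
move=> a0; have [r0 ra] := residue_reprP a0; apply/andP; split; first exact/asboolP.
apply/eqP/residue_repr_eq; rewrite -opprB; exact: vgeN.
Qed.

Definition to_residue (a : F) : residue :=
  insubd (Residue (residue_sub (vge0 v 0))) (residue_repr a).

Local Notation red := to_residue.

Lemma residue_valP (z : residue) : vge v (val z) 0.
Proof. by have /andP[/asboolP] := valP z. Qed.

Lemma red_val a : vge v a 0 -> vge v (a - val (red a)) 1.
Proof.
move=> a0; rewrite val_insubd residue_sub //.
by have [] := residue_reprP a0.
Qed.

Lemma red_eq a b : vge v (a - b) 1 -> red a = red b.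
Proof. by move=> ab; rewrite /red (residue_repr_eq ab). Qed.

Lemma val_red z : red (val z) = z.
Proof.
apply: val_inj; rewrite val_insubd residue_sub; last exact: residue_valP.
by have /andP[_ /eqP] := valP z.
Qed.

Lemma red_eqP a b : vge v a 0 -> vge v b 0 -> red a = red b <-> vge v (a - b) 1.
Proof.
move=> a0 b0; split; last exact: red_eq.
move=> E; have -> : a - b = (a - val (red a)) - (b - val (red b)) by rewrite E; ring.
by apply: vgeB => //; apply: red_val.
Qed.

Let rv := residue_valP.
Definition residue_add (x y : residue) : residue := red (val x + val y).
Definition residue_opp (x : residue) : residue := red (- val x).
Definition residue_mul (x y : residue) : residue := red (val x * val y).
Definition residue_inv (x : residue) : residue := if x == red 0 then red 0 else red (val x)^-1.

Lemma redD a b : vge v a 0 -> vge v b 0 -> residue_add (red a) (red b) = red (a + b).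
Proof.
move=> a0 b0; apply: red_eq; rewrite -opprB; apply: vgeN => //.
have -> : a + b - (val (red a) + val (red b)) = (a - val (red a)) + (b - val (red b)) by ring.
by apply: vgeD => //; apply: red_val.
Qed.

Lemma redM a b : vge v a 0 -> vge v b 0 -> residue_mul (red a) (red b) = red (a * b).
Proof.
move=> a0 b0; apply: red_eq; rewrite -opprB; apply: vgeN => //.
have -> : a * b - val (red a) * val (red b) =
  (a - val (red a)) * b + val (red a) * (b - val (red b)) by ring.
apply: vgeD => //.
- by rewrite -[X in vge _ _ X]addr0; exact: (vgeM pv (red_val a0) b0).
- by rewrite -[X in vge _ _ X]add0r; exact: (vgeM pv (rv _) (red_val b0)).
Qed.

Lemma redN a : vge v a 0 -> residue_opp (red a) = red (- a).
Proof.
move=> a0; apply: red_eq; rewrite opprK addrC; exact: red_val.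
Qed.

Fact residue_addA : associative residue_add.
Proof.
move=> x y z; rewrite -(val_red x) -(val_red y) -(val_red z).
by rewrite !redD ?addrA //; try apply: vgeD => //; apply: rv.
Qed.
Fact residue_addC : commutative residue_add.
Proof. by move=> x y; rewrite /residue_add addrC. Qed.
Fact residue_add0 : left_id (red 0) residue_add.
Proof.
by move=> x; rewrite -(val_red x) redD ?add0r //; first [exact: rv|exact: vge0].
Qed.
Fact residue_addN : left_inverse (red 0) residue_opp residue_add.
Proof.
move=> x; rewrite -(val_red x) redN; last exact: rv.
by rewrite redD ?addNr //; try apply: vgeN => //; apply: rv.
Qed.

HB.instance Definition _ := GRing.isZmodule.Build residue
  residue_addA residue_addC residue_add0 residue_addN.

Fact residue_mulA : associative residue_mul.
Proof.
move=> x y z; rewrite -(val_red x) -(val_red y) -(val_red z).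
by rewrite !redM ?mulrA //; try apply: vgeM0 => //; apply: rv.
Qed.
Fact residue_mulC : commutative residue_mul.
Proof. by move=> x y; rewrite /residue_mul mulrC. Qed.
Fact residue_mul1 : left_id (red 1) residue_mul.
Proof.
by move=> x; rewrite -(val_red x) redM ?mul1r //; first [exact: rv|exact: vge1].
Qed.
Fact residue_mulD : left_distributive residue_mul residue_add.
Proof.
move=> x y z; rewrite -(val_red x) -(val_red y) -(val_red z).
have h := rv.
have hM (a b : residue) : vge v (val a * val b) 0 by apply: vgeM0.
have hD (a b : residue) : vge v (val a + val b) 0 by apply: vgeD.
by rewrite redD // !redM // redD // mulrDl.
Qed.
Fact residue_nz : red 1 != red 0.
Proof.
apply/eqP => /red_eqP; rewrite subr0 => /(_ (vge1 pv) (vge0 _ _))[].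
  by move/eqP; rewrite oner_eq0.
by rewrite pval1.
Qed.

HB.instance Definition _ := GRing.Zmodule_isComNzRing.Build residue
  residue_mulA residue_mulC residue_mul1 residue_mulD residue_nz.

Fact residue_mulV : forall x : residue, x != 0 -> residue_inv x * x = 1.
Proof.
move=> x x0; rewrite /residue_inv (negPf x0).
have [xz|vx] : val x = 0 \/ v (val x) = 0.
- case: (rv x) => [->|ge]; first by left.
  right; apply/eqP; rewrite eq_le ge andbT leNgt; apply/negP => gt.
  case/eqP: x0; rewrite -(val_red x); apply: red_eq; rewrite subr0; right.
  by lia.
- by case/eqP: x0; rewrite -(val_red x) xz.
have x1 : val x != 0 by apply: contraNneq x0 => xz; rewrite -(val_red x) xz.
by rewrite -{2}(val_red x) [LHS]redM ?mulVf //; first [exact: rv|right; rewrite pvalV // vx].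
Qed.
Fact residue_invr0 : residue_inv 0 = 0.
Proof. by rewrite /residue_inv eqxx. Qed.

HB.instance Definition _ := GRing.ComNzRing_isField.Build residue
  residue_mulV residue_invr0.

End ResidueField.

Lemma deriv_neq0 (k : fieldType) (p : {poly k}) : [pchar k] =i pred0 ->
  (1 < size p)%N -> p^`() != 0.
Proof.
move=> ch sp; have p0 : p != 0 by rewrite -size_poly_gt0; lia.
apply/eqP => /(congr1 (fun q : {poly k} => q`_(size p).-2)).
have E : (size p).-2.+1 = (size p).-1 by lia.
rewrite coef_deriv coef0 E -lead_coefE -mulr_natr => /eqP.
rewrite mulf_eq0 lead_coef_eq0 (negPf p0) /=.
by have /pcharf0P -> := ch; case: (size p) sp => [|[|n]].
Qed.

(** * Primitive elements of residue fields *)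

(** An annihilating polynomial of least degree has no proper factor in common
    with its derivative, which in characteristic zero is nonzero and of smaller
    degree. *)
Lemma separable_annihilator (k M : fieldType) (e : {rmorphism k -> M}) (z : M) :
  [pchar k] =i pred0 -> algebraicOver e z ->
  exists h : {poly k}, separable_poly h /\ root (map_poly e h) z.
Proof.
move=> ch [p p0 pz].
pose P n := `[< exists h : {poly k}, [/\ h != 0, root (map_poly e h) z & size h = n] >].
have exP : exists n, P n by exists (size p); apply/asboolP; exists p.
case: (ex_minnP exP) => n /asboolP[h [h0 hz <-]] hmin; exists h; split=> //.
have min g : g != 0 -> root (map_poly e g) z -> (size h <= size g)%N.
  by move=> g0 gz; apply: hmin; apply/asboolP; exists g.
have sh : (1 < size h)%N.
  rewrite ltnNge; apply/negP => /size1_polyC E; move: hz h0; rewrite E.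
  by rewrite map_polyC rootE hornerC fmorph_eq0 polyC_eq0 => ->.
have h'0 := deriv_neq0 ch sh.
set g := gcdp h h^`().
have gh : g %| h by apply: dvdp_gcdl.
have g0 : g != 0 by rewrite gcdp_eq0 negb_and h0.
have sg : (size g < size h)%N.
  apply: leq_ltn_trans (lt_size_deriv h0).
  by apply: dvdp_leq => //; apply: dvdp_gcdr.
have E := divpK gh; have r0 : h %/ g != 0 by rewrite divpN0 // dvdp_leq.
have : root (map_poly e (h %/ g * g)) z by rewrite E.
rewrite rmorphM rootM => /orP[rz|gz]; last first.
  by have := min _ g0 gz; rewrite leqNgt sg.
have sle : ((size (h %/ g)%R + size g).-1 <= size (h %/ g)%R)%N.
  by rewrite -size_mul // E; apply: min.
have g1 : (0 < size g)%N by rewrite size_poly_gt0.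
rewrite unlock /coprimep -/g; move: sle g1.
by case: (size g) => [|[|b]] //; rewrite !addnS /= => + _; rewrite ltnNge leq_addr.
Qed.

Lemma primitive_element_seq (k M : fieldType) (e : {rmorphism k -> M}) (s : seq M) :
  [pchar k] =i pred0 -> (forall z, algebraicOver e z) ->
  exists z (h : {poly k}), [/\ separable_poly h, root (map_poly e h) z &
    forall y, y \in s -> exists p, (map_poly e p).[z] = y].
Proof.
move=> ch alg; elim: s => [|y s [x [h [sh hx xs]]]].
  by have [h [sh h0]] := separable_annihilator ch (alg 0); exists 0, h; split.
have [q q0 qy] := alg y.
have h0 : h != 0 by apply: separable_poly_neq0.
have [n [[r rx] [r' ry]]] := pchar0_PET h0 hx q0 qy ch.
set z := y *+ n - x in rx ry.
have [h' [sh' h'z]] := separable_annihilator ch (alg z).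
exists z, h'; split=> // w; rewrite inE => /orP[/eqP->|/xs[p <-]]; first by exists r'.
by exists (p \Po r); rewrite map_comp_poly horner_comp rx.
Qed.

(** The primitive element theorem in the residue field, phrased with
    representatives, so that no residue field is visible in its use. *)
Lemma residue_primitive (k M : fieldType) (c : {rmorphism k -> M}) (v : valuation M) :
  [pchar k] =i pred0 -> (forall a, v (c a) = 0) ->
  (forall b, vge v b 0 -> exists h : {poly k}, h != 0 /\ vge v (map_poly c h).[b] 1) ->
  forall bs : seq M, (forall b, b \in bs -> vge v b 0) ->
  exists z (h : {poly k}), [/\ vge v z 0, separable_poly h,
    vge v (map_poly c h).[z] 1 &
    forall b, b \in bs -> exists p : {poly k}, vge v (b - (map_poly c p).[z]) 1].
Proof.
move=> ch vc ra bs bs0; have pv := valuation_preval v.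
have c0 a : vge v (c a) 0 by right; rewrite vc.
pose e a := to_residue v (c a).
have eD : zmod_morphism e.
  move=> a b; by rewrite /e rmorphB -redD -?redN //; apply: vgeN.
have eM : monoid_morphism e.
  split=> [|a b]; first by rewrite /e rmorph1.
  by rewrite /e rmorphM -redM.
pose mD := GRing.isZmodMorphism.Build k (residue v) e eD.
pose mM := GRing.isMonoidMorphism.Build k (residue v) e eM.
have [eR eRE] : exists eR : {rmorphism k -> residue v}, forall a, eR a = to_residue v (c a).
  by exists (HB.pack e mD mM : {rmorphism k -> residue v}).
have redE (p : {poly k}) b : vge v b 0 ->
    to_residue v (map_poly c p).[b] = (map_poly eR p).[to_residue v b].
  move=> b0; elim/poly_ind: p => [|p a IH]; first by rewrite !rmorph0 !horner0.
  rewrite !rmorphD !rmorphM /= !map_polyX !map_polyC !hornerMXaddC -IH.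
  rewrite [X in _ = _ + X](eRE a : _ = _).
  have pb0 : vge v (map_poly c p).[b] 0.
    by apply: vge_horner => // i; rewrite coef_map; apply: c0.
  by rewrite -redD -?redM //; [apply: vgeM0|apply: c0].
have alg z : algebraicOver eR z.
  have [h [h0 hz]] := ra _ (residue_valP z); exists h => //.
  have := redE h _ (residue_valP z); rewrite val_red => E.
  by rewrite rootE -E; apply/eqP/red_eq; rewrite subr0.
have [z [h [sh hz zs]]] := primitive_element_seq (map (to_residue v) bs) ch alg.
have z0 := residue_valP z.
have h0 (p : {poly k}) : vge v (map_poly c p).[val z] 0.
  by apply: vge_horner => // i; rewrite coef_map; apply: c0.
exists (val z), h; split=> //.
  have := redE h _ z0; rewrite val_red (eqP hz) => /red_eqP.
  by rewrite subr0; apply=> //; apply: vge0.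
move=> b bbs; have [p pb] := zs _ (map_f (to_residue v) bbs).
exists p; apply/red_eqP => //; first exact: bs0.
by rewrite redE // val_red pb.
Qed.

(** * Composites with a trivially valued field are unramified *)

Section Unramified.
Variables (k K K' D : fieldType).
Variables (c : {rmorphism k -> K}) (c' : {rmorphism k -> K'}) (x' : K').
Variables (i : {rmorphism K -> D}) (i' : {rmorphism K' -> D}).
Hypothesis ch : [pchar k] =i pred0.
Hypothesis ic : forall a, i (c a) = i' (c' a).
Hypothesis gen : forall S : {pred D}, divring_closed S ->
  (forall a, i a \in S) -> (forall b, i' b \in S) -> forall d, d \in S.
Hypothesis genK' : algebraic_generator c' x'.
Variables (m : valuation D) (o' : valuation K') (e : nat).
Hypothesis mi : forall a, m (i a) = 0.
Hypothesis oc : forall a, o' (c' a) = 0.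
Hypothesis e0 : (0 < e)%N.
Hypothesis mi' : forall b, m (i' b) = e%:Z * o' b.

Let pm := valuation_preval m.
Let po := valuation_preval o'.

(** The ring composite of K and the valuation ring of o'. *)
Inductive composite : D -> Prop :=
| composite_mul a b : vge o' b 0 -> composite (i a * i' b)
| composite_add s t : composite s -> composite t -> composite (s + t).

Lemma composite_sum s : composite s -> exists l : seq (K * K'),
  (forall p, p \in l -> vge o' p.2 0) /\ s = \sum_(p <- l) i p.1 * i' p.2.
Proof.
elim=> [a b b0|s1 s2 _ [l1 [l1P ->]] _ [l2 [l2P ->]]].
  by exists [:: (a, b)]; rewrite big_seq1; split=> // p; rewrite inE => /eqP->.
exists (l1 ++ l2); rewrite big_cat; split=> // p.
by rewrite mem_cat => /orP[/l1P|/l2P].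
Qed.

Lemma compositeM s t : composite s -> composite t -> composite (s * t).
Proof.
move=> hs; elim: hs t => [a b b0|s1 s2 _ IH1 _ IH2] t ht; last first.
  by rewrite mulrDl; apply: composite_add; [apply: IH1|apply: IH2].
elim: ht => [a2 b2 b20|t1 t2 _ IH1 _ IH2]; last first.
  by rewrite mulrDr; apply: composite_add.
by rewrite mulrACA -!rmorphM; apply: composite_mul; apply: vgeM0.
Qed.

Lemma composite_l a : composite (i a).
Proof. by rewrite -[i a]mulr1 -(rmorph1 i'); apply: composite_mul; apply: vge1. Qed.

Lemma composite_r b : vge o' b 0 -> composite (i' b).
Proof. by move=> b0; rewrite -[i' b]mul1r -(rmorph1 i); apply: composite_mul. Qed.

Lemma compositeN s : composite s -> composite (- s).
Proof.
move=> hs; rewrite -mulN1r -(rmorph1 i) -rmorphN.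
by apply: compositeM => //; apply: composite_l.
Qed.

Lemma composite_horner (p : {poly K}) b : vge o' b 0 ->
  composite (map_poly i p).[i' b].
Proof.
move=> b0; elim/poly_ind: p => [|p a IH].
  by rewrite rmorph0 horner0 -(rmorph0 i); apply: composite_l.
rewrite rmorphD rmorphM /= map_polyX map_polyC hornerMXaddC.
apply: composite_add; last exact: composite_l.
by apply: compositeM => //; apply: composite_r.
Qed.

Lemma mi'_vge b n : vge o' b n -> vge m (i' b) (e%:Z * n).
Proof.
case=> [->|h]; first by left; rewrite rmorph0.
by right; rewrite mi' ler_pM2l.
Qed.

Lemma mi_vge a : vge m (i a) 0.
Proof. by right; rewrite mi. Qed.

Lemma composite_vge s : composite s -> vge m s 0.
Proof.
elim=> [a b b0|s1 s2 _ h1 _ h2]; last exact: vgeD.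
apply: vgeM0 => //; first exact: mi_vge.
by have := mi'_vge b0; rewrite mulr0.
Qed.

(** Modulo t, the elements of K' that occur in s are polynomials over k in a
    single z, a root of a separable h; so s is congruent to F(z) with F in K[X].
    Since F(z) has positive value, F is not prime to h: with G = gcd(F, h) and
    h = H G, the cofactor H is prime to F, as h is separable, so H(z) is a unit,
    while H F is a multiple of h. Hence H(z) s is divisible by t in the
    composite, without any completion. *)
Lemma composite_divide (t : K') s : o' t = 1 -> composite s -> vge m s 1 ->
  exists H s', [/\ composite s', H != 0, m H = 0 & H * s = i' t * s'].
Proof.
move=> vt hs s1; have [l [lP sE]] := composite_sum hs.
have t0 : t != 0 by apply: contra_eq_neq vt => ->; rewrite Defs.val0.
have [|z [h [z0 sh hz zl]]] := @residue_primitive _ _ _ _ ch oc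
    (residue_algebraic genK' oc) [seq p.2 | p <- l].
  by move=> b /mapP[p pl ->]; apply: lP.
have ex_p (p : K * K') : exists q : {poly k}, p \in l ->
    vge o' (p.2 - (map_poly c' q).[z]) 1.
  have [pl|] := boolP (p \in l); last by exists 0.
  by have [q qP] := zl _ (map_f _ pl); exists q.
have [q qP] := choice ex_p.
have kE (r : {poly k}) : i' (map_poly c' r).[z] = (map_poly i (map_poly c r)).[i' z].
  rewrite -horner_map -!map_poly_comp; congr _.[_]; apply: eq_map_poly => a.
  by rewrite /= ic.
pose FK : {poly K} := \sum_(p <- l) p.1 *: map_poly c (q p).
pose hK := map_poly c h.
have FE : (map_poly i FK).[i' z] = \sum_(p <- l) i p.1 * i' (map_poly c' (q p)).[z].
  rewrite rmorph_sum horner_sum; apply: eq_bigr => p _.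
  by rewrite /= map_polyZ hornerZ kE.
have [s2 [hs2 s2E]] : exists s2, composite s2 /\ s = (map_poly i FK).[i' z] + i' t * s2.
  exists (\sum_(p <- l) i p.1 * i' ((p.2 - (map_poly c' (q p)).[z]) / t)); split.
    rewrite big_seq; apply: (big_ind composite) => [||p pl].
    - by rewrite -(rmorph0 i); apply: composite_l.
    - exact: composite_add.
    - apply: composite_mul.
      have := vgeM po (qP _ pl) (_ : vge o' t^-1 (-1)); rewrite subrr; apply.
      by right; rewrite pvalV // vt.
  rewrite FE sE mulr_sumr -big_split; apply: eq_bigr => p _ /=.
  rewrite mulrCA -rmorphM mulrCA mulfV // mulr1 -mulrDr -rmorphD.
  by rewrite addrC subrK.
have h0 : h != 0 by apply: separable_poly_neq0.
have hK0 : hK != 0 by rewrite map_poly_eq0.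
pose G := gcdp FK hK; pose H1 := hK %/ G; pose F1 := FK %/ G.
have hE : H1 * G = hK by rewrite divpK // dvdp_gcdr.
have fE : F1 * G = FK by rewrite divpK // dvdp_gcdl.
have coHF : coprimep H1 FK.
  rewrite -fE coprimepMr; apply/andP; split.
    by rewrite coprimep_sym; apply: coprimep_div_gcd; rewrite hK0 orbT.
  have : separable_poly (H1 * G) by rewrite hE separable_map.
  by rewrite separable_mul => /and3P[].
pose ev (r : {poly K}) := (map_poly i r).[i' z].
have ev0 r : vge m (ev r) 0 by apply: composite_vge; apply: composite_horner.
have F_1 : vge m (ev FK) 1.
  have -> : ev FK = s - i' t * s2 by rewrite s2E addrK.
  apply: vgeB => //; rewrite -[X in vge _ _ X]addr0; apply: vgeM => //.
    by right; rewrite mi' vt mulr1; lia.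
  exact: composite_vge.
have [H_0 mH] : ev H1 != 0 /\ m (ev H1) = 0.
  have [u] := Bezout_coprimepP _ _ coHF.
  rewrite -size_poly_eq1 => /size_poly1P[a a0 aE].
  have evE : ev (u.1 * H1 + u.2 * FK) = i a.
    by rewrite /ev aE map_polyC hornerC.
  rewrite /ev rmorphD !rmorphM /= hornerD !hornerM -!/(ev _) in evE.
  have [bad|] := pselect (vge m (ev H1) 1); last first.
    move=> /not_orP[/eqP nz /negP lt]; split=> //.
    by case: (ev0 H1) => [/eqP|]; [rewrite (negPf nz)|lia].
  have : vge m (i a) 1.
    rewrite -evE; apply: vgeD => //; rewrite -[X in vge _ _ X]add0r.
      exact: (vgeM pm (ev0 _) bad).
    exact: (vgeM pm (ev0 _) F_1).
  by case=> [/eqP|]; [rewrite fmorph_eq0 (negPf a0)|rewrite mi].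
exists (ev H1), (i' ((map_poly c' h).[z] / t) * ev F1 + ev H1 * s2); split=> //.
  apply: composite_add; apply: compositeM => //; try exact: composite_horner.
  apply: composite_r.
  have := vgeM po hz (_ : vge o' t^-1 (-1)); rewrite subrr; apply.
  by right; rewrite pvalV // vt.
rewrite s2E mulrDr [RHS]mulrDr; congr (_ + _); last by rewrite mulrCA.
rewrite mulrA -rmorphM mulrCA mulfV // mulr1 kE -/hK -/(ev hK) -hE -/(ev FK) -fE.
by rewrite /ev !rmorphM /= !hornerM; ring.
Qed.

(** Dividing by t lowers the value by e; descend until it is 0. *)
Lemma composite_value s : composite s -> s != 0 -> exists n, m s = e%:Z * n.
Proof.
have [t t0 vt] := val_normalized o'.
move: {2}`|m s|%N.+1 (ltnSn `|m s|%N) => N; elim: N s => // N IH s lt hs s0.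
have ms : 0 <= m s.
  by case: (composite_vge hs) => [/eqP|//]; rewrite (negPf s0).
have [ms0|ms1] := eqVneq (m s) 0; first by exists 0; rewrite ms0 mulr0.
have [|H [s' [hs' H0 mH E]]] := composite_divide vt hs; first by right; lia.
have it0 : i' t != 0 by rewrite fmorph_eq0.
have s'0 : s' != 0.
  apply: contraNneq s0 => s'0; move/eqP: E.
  by rewrite s'0 mulr0 mulf_eq0 (negPf H0).
have mE : m s = e%:Z + m s'.
  by have := congr1 m E; rewrite !pvalM // mH mi' vt mulr1 add0r.
have ms' : 0 <= m s'.
  by case: (composite_vge hs') => [/eqP|//]; rewrite (negPf s'0).
have [|n nE] := IH s' _ hs' s'0; first by lia.
by exists (1 + n); rewrite mE nE; lia.
Qed.

(** Every element of D is a quotient of elements of the composite, whose values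
    are multiples of e; but m takes the value 1. *)
Theorem composite_unramified : e = 1%N.
Proof.
pose S : {pred D} := fun d => `[< exists s1 s2,
  [/\ composite s1, composite s2, s2 != 0 & d = s1 / s2] >].
have h1 : composite 1 by rewrite -(rmorph1 i); apply: composite_l.
have h0 : composite 0 by rewrite -(rmorph0 i); apply: composite_l.
have all_S d : d \in S.
  apply: gen.
  - split.
    + by apply/asboolP; exists 1, 1; rewrite divr1 oner_neq0.
    + move=> _ _ /asboolP[s1 [s2 [c1 c2 n2 ->]]] /asboolP[t1 [t2 [d1 d2 m2 ->]]].
      apply/asboolP; exists (s1 * t2 - t1 * s2), (s2 * t2); split.
      * by apply: composite_add; [|apply: compositeN]; apply: compositeM.
      * exact: compositeM.
      * by rewrite mulf_neq0.
      * by field; rewrite n2 m2.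
    + move=> _ _ /asboolP[s1 [s2 [c1 c2 n2 ->]]] /asboolP[t1 [t2 [d1 d2 m2 ->]]].
      have [->|t10] := eqVneq t1 0.
        by apply/asboolP; exists 0, 1; rewrite !mul0r invr0 mulr0 oner_neq0.
      apply/asboolP; exists (s1 * t2), (s2 * t1); split.
      * exact: compositeM.
      * exact: compositeM.
      * by rewrite mulf_neq0.
      * by field; rewrite n2 m2 t10.
  - by move=> a; apply/asboolP; exists (i a), 1; rewrite divr1 oner_neq0;
      split=> //; apply: composite_l.
  - move=> b; apply/asboolP; have [lt|ge] := ltP (o' b) 0.
      have b0 : b != 0 by apply: contraTneq lt => ->; rewrite Defs.val0.
      exists 1, (i' b^-1); rewrite fmorph_eq0 invr_eq0 b0 fmorphV invrK mul1r; split=> //.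
      by rewrite -fmorphV; apply: composite_r; right; rewrite pvalV //; lia.
    exists (i' b), 1; rewrite divr1 oner_neq0; split=> //.
    by apply: composite_r; right.
have [d d0 md] := val_normalized m.
have /asboolP[s1 [s2 [c1 c2 n2 dE]]] := all_S d.
have n1 : s1 != 0 by apply: contraNneq d0 => s10; rewrite dE s10 mul0r.
have [n1' E1] := composite_value c1 n1; have [n2' E2] := composite_value c2 n2.
move: md; rewrite dE pvalM ?invr_eq0 // pvalV // E1 E2 -mulrBr => E.
have /dvdzP : exists q, 1 = q * e%:Z by exists (n1' - n2'); rewrite mulrC E.
by rewrite dvdz1 => /eqP.
Qed.

End Unramified.

(** * Valuations of double fields *)

Lemma proportional_valuations (F : fieldType) (v v' : valuation F) (a b : nat) :
  (0 < a)%N -> (0 < b)%N -> (forall x, a%:Z * v x = b%:Z * v' x) -> a = b /\ v = v'.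
Proof.
move=> a0 b0 E; have [p _ vp] := val_normalized v; have [q _ vq] := val_normalized v'.
have Ep := E p; have Eq := E q; rewrite vp mulr1 in Ep; rewrite vq mulr1 in Eq.
have x0 : 0 < v' p by rewrite -(pmulr_rgt0 _ (_ : 0 < b%:Z)) // -Ep.
have y0 : 0 < v q by rewrite -(pmulr_rgt0 _ (_ : 0 < a%:Z)) // Eq.
have ab : a = b.
  have le1 : a%:Z <= b%:Z by rewrite -Eq ler_peMr.
  have le2 : b%:Z <= a%:Z by rewrite Ep ler_peMr.
  by apply/eqP; rewrite -eqz_nat eq_le le1 le2.
split=> //; apply: valuation_eq => x; apply: (@mulfI _ a%:Z); first by lia.
by rewrite E ab.
Qed.

(** A valuation trivial on F would be trivial on the algebraic extension L. *)
Lemma restrict_valuation (F : fieldType) (L : fieldExtType F) (w : valuation L) :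
  exists (v : valuation F) (e : nat), lies_above (in_alg L) v w e.
Proof.
have pw := valuation_preval w.
have [||e [v [e0 E]]] := @preval_normalize _ (w \o in_alg L).
- exact: preval_comp.
- apply: contrapT => H; have [t _ wt] := val_normalized w.
  have : w t = 0.
    apply: (pval_algebraic0 pw (e := in_alg L)) (algebraicOver_ext t) => c.
    by apply: contrapT => /eqP nz; apply: H; exists c.
  by rewrite wt.
- by exists v, e; split.
Qed.

Lemma trivial_ext (F : fieldType) (L : fieldExtType F) (M : fieldType)
    (g : {rmorphism L -> M}) (w : valuation M) :
  (forall a, w (g a%:A) = 0) -> forall b, w (g b) = 0.
Proof.
move=> tr b; have pw := preval_comp g (valuation_preval w).
exact: (pval_algebraic0 pw (e := in_alg L) tr (algebraicOver_ext b)).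
Qed.

(** Only the term of lowest degree counts. *)
Lemma monomial_value (K D : fieldType) (i : {rmorphism K -> D}) (t : D) (p : {poly K}) :
  p != 0 -> exists n : nat, forall w : valuation D,
    (forall a, w (i a) = 0) -> 0 < w t ->
    (map_poly i p).[t] != 0 /\ w (map_poly i p).[t] = n%:Z * w t.
Proof.
move=> p0; have [n [q + E]] := multiplicity_XsubC p 0; rewrite p0 /= => q0.
exists n => w wi wt; have pw := valuation_preval w.
have t0 : t != 0 by apply: contraTneq wt => ->; rewrite Defs.val0.
have q00 : i q.[0] != 0 by rewrite fmorph_eq0.
have [r qE] : exists r, q = r * 'X + (q.[0])%:P.
  have /factor_theorem[r rE] : root (q - (q.[0])%:P) 0.
    by rewrite rootE hornerD hornerN hornerC subrr.
  by exists r; rewrite -[LHS](subrK (q.[0])%:P) rE subr0.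
have [qt wq] : (map_poly i q).[t] != 0 /\ w (map_poly i q).[t] = w (i q.[0]).
  rewrite qE rmorphD rmorphM /= map_polyX map_polyC hornerMXaddC addrC.
  rewrite hornerD hornerM hornerX mulr0 hornerC add0r.
  apply: pvalD_eq => //; rewrite wi -[X in vge _ _ X]add0r.
  apply: vgeM => //; last by right; lia.
  by apply: vge_horner => // [l|]; [rewrite coef_map; right; rewrite wi|right; lia].
rewrite polyC0 subr0 in E; rewrite E rmorphM rmorphXn /= map_polyX.
rewrite hornerM hornerXn mulf_neq0 ?expf_neq0 //; split=> //.
by rewrite pvalM ?expf_neq0 // pvalX // wq wi add0r.
Qed.

(** The coefficients of an equation of b over K(t) have values proportional to
    w(t), uniformly in w, and the leading one bounds the poles of b. *)
Lemma bounded_poles (K D E : fieldType) (i : {rmorphism K -> D}) (t : D)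
    (e : {rmorphism E -> D}) (b : D) :
  (forall z, exists p q : {poly K},
    (map_poly i q).[t] != 0 /\ e z = (map_poly i p).[t] / (map_poly i q).[t]) ->
  (exists z, e z = t) ->
  algebraicOver e b ->
  exists C : nat, forall w : valuation D,
    (forall a, w (i a) = 0) -> 0 < w t -> vge w b (- (C%:Z * w t)).
Proof.
move=> eE [tE tEE] [P P0 Pb].
have ex_n z : exists n : int, z != 0 -> forall w : valuation D,
    (forall a, w (i a) = 0) -> 0 < w t -> w (e z) = n * w t.
  have [->|z0] := eqVneq z 0; first by exists 0.
  have [p [q [q0 zE]]] := eE z.
  have p0 : p != 0.
    apply: contraNneq z0 => p0; move/eqP: zE.
    by rewrite p0 rmorph0 horner0 mul0r fmorph_eq0.
  have qn : q != 0 by apply: contraNneq q0 => ->; rewrite rmorph0 horner0.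
  have [n nE] := monomial_value i t p0; have [n' n'E] := monomial_value i t qn.
  exists (n%:Z - n'%:Z) => _ w wi wt; have pw := valuation_preval w.
  have [p1 wp] := nE w wi wt; have [q1 wq] := n'E w wi wt.
  by rewrite zE pvalM ?invr_eq0 // pvalV // wp wq mulrBl.
have [n nE] := choice ex_n.
have [r rP] := seq_bound (P : seq E) (fun z => - n z).
exists (r + `|n (lead_coef P)|)%N => w wi wt; have pw := valuation_preval w.
have t0 : t != 0 by apply: contraTneq wt => ->; rewrite Defs.val0.
have tE0 : tE != 0 by rewrite -(fmorph_eq0 e) tEE.
pose Q : {poly E} := (tE ^+ r)%:P * P.
have Q0 : Q != 0 by rewrite mulf_neq0 // polyC_eq0 expf_neq0.
have H : vge w b (- w (lead_coef (map_poly e Q))).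
  apply: vge_root => //; first by rewrite map_poly_eq0.
    move=> l; rewrite coef_map /Q coefCM /= rmorphM rmorphXn /= tEE.
    have [->|Pl] := eqVneq P`_l 0; first by left; rewrite rmorph0 mulr0.
    right; rewrite pvalM ?expf_neq0 ?fmorph_eq0 // pvalX // nE //.
    have /rP : P`_l \in (P : seq E); last first.
      by move=> /= h; rewrite -mulrDl mulr_ge0 ?(ltW wt) //; lia.
    by apply: mem_nth; rewrite ltnNge; apply: contra Pl => h; rewrite nth_default.
  by rewrite rmorphM /= rootE hornerM (eqP Pb) mulr0.
apply: vge_le H.
rewrite lead_coef_map /Q lead_coefM lead_coefC /= rmorphM rmorphXn /= tEE.
rewrite pvalM ?expf_neq0 ?fmorph_eq0 ?lead_coef_eq0 // pvalX // nE ?lead_coef_eq0 //.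
rewrite -mulrDl lerN2 ler_pM2r //.
by rewrite PoszD lerD2l abszE ler_norm.
Qed.

(** * The multiple ideals of a divisor and of its extension *)

Section Main.
Variables (k : fieldExtType rat) (K K' : fieldExtType {fraction {poly k}}).
Variables (D : fieldType) (i : {rmorphism K -> D}) (i' : {rmorphism K' -> D}).
Hypothesis hD : is_double_field (ff_const K) (ff_var K) (ff_const K') (ff_var K') i i'.
Variables (Kt' : fieldExtType K') (Dt : fieldExtType D).
Variables (it : {rmorphism K -> Dt}) (it' : {rmorphism Kt' -> Dt}).
Hypothesis hDt : is_double_field (ff_const K) (ff_var K)
  (in_alg Kt' \o ff_const K') (in_alg Kt' (ff_var K')) it it'.
Hypothesis hit : forall a : K, it a = in_alg Dt (i a).
Hypothesis hit' : forall b : K', it' (in_alg Kt' b) = in_alg Dt (i' b).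
Variables (o : valuation K) (o' : valuation K') (ot' : valuation Kt').
Hypothesis ho : trivial_on (ff_const K) o.
Hypothesis ho' : trivial_on (ff_const K') o'.
Hypothesis hot' : above (in_alg Kt') o' ot'.

Local Notation j := (in_alg Dt).

Let controlled (m : valuation D) :=
  [\/ binary i i' m, unary_at i i' o m | unary_at' i i' o' m].
Let controlled_t (mt : valuation Dt) :=
  [\/ binary it it' mt, unary_at it it' o mt | unary_at' it it' ot' mt].

Lemma char_k : [pchar k] =i pred0.
Proof. by move=> p; rewrite pchar_lalg pchar_num. Qed.

Lemma char_K' : [pchar K'] =i pred0.
Proof. by move=> p; rewrite -(char_k p) (fmorph_pchar (ff_const K')). Qed.

Lemma char_D : [pchar D] =i pred0.
Proof. by move=> p; rewrite -(char_K' p) (fmorph_pchar i'). Qed.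

Lemma generator_Kt' :
  algebraic_generator (in_alg Kt' \o ff_const K') (in_alg Kt' (ff_var K')).
Proof. exact/algebraic_generator_ext/function_field_generator. Qed.

Lemma above_trivial (v : valuation Kt') : above (in_alg Kt') o' v ->
  forall a, v (in_alg Kt' (ff_const K' a)) = 0.
Proof. by move=> [e [_ ve]] a; rewrite ve ho' mulr0. Qed.

(** In the K-unary case the restriction is unramified because the values of o
    are attained on K. In the other unary case it is the valuation of D that has
    to be unramified over o', by composite_unramified. *)
Lemma controlled_restrict (mt : valuation Dt) : controlled_t mt ->
  exists m e, lies_above j m mt e /\ controlled m.
Proof.
move=> tmt; have [m [e me]] := restrict_valuation mt.
exists m, e; split=> //; case: me => e0 me.
have e0z : e%:Z != 0 by lia.
have cancel0 a : e%:Z * m a = 0 -> m a = 0.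
  by move/eqP; rewrite mulf_eq0 (negPf e0z) => /eqP.
have mi a : mt (it a) = e%:Z * m (i a) by rewrite hit me.
have mi' b : mt (it' (in_alg Kt' b)) = e%:Z * m (i' b) by rewrite hit' me.
have [_ _ gen] := hD.
case: tmt => [[tr tr']|[[tr' ntr] at_o]|[[tr ntr'] at_o']].
- constructor 1; split=> a; apply: cancel0; first by rewrite -mi.
  by rewrite -mi'.
- have oE a : 1%:Z * o a = e%:Z * m (i a) by rewrite mul1r -mi at_o.
  have e1 : e = 1%N.
    have [p p0 vp] := val_normalized o; have := oE p; rewrite vp => /esym E.
    have : (e%:Z %| 1)%Z by apply/dvdzP; exists (m (i p)); rewrite mulrC E.
    by rewrite dvdz1 => /eqP.
  have moE a : m (i a) = o a by have := oE a; rewrite e1 !mul1r.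
  constructor 2; split=> //; split; first by move=> b; apply: cancel0; rewrite -mi'.
  move=> tri; have [p p0 vp] := val_normalized o.
  by have := moE p; rewrite tri vp.
- have [eo [eo0 oE]] := hot'.
  have E b : e%:Z * m (i' b) = eo%:Z * o' b by rewrite -mi' at_o' oE.
  have [||e2 [o2 [e20 o2E]]] := @preval_normalize _ (m \o i').
  + exact/preval_comp/valuation_preval.
  + have [p p0 vp] := val_normalized o'; exists p; apply: contra_eq_neq (E p) => /= ->.
    by rewrite mulr0 vp mulr1; lia.
  have [_ o2o] : (e * e2)%N = eo /\ o2 = o'.
    apply: proportional_valuations => // [|b]; first by rewrite muln_gt0 e0.
    by rewrite PoszM -mulrA -o2E /= E.
  have tri a : m (i a) = 0 by apply: cancel0; rewrite -mi.
  have e21 : e2 = 1%N.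
    apply: (@composite_unramified _ _ _ _ (ff_const K) (ff_const K') (ff_var K') i i'
      char_k _ gen (function_field_generator (K := K')) m o') => //.
    - by have [] := hD.
    - by move=> b; rewrite -o2o -o2E.
  have moE b : m (i' b) = o' b by have := o2E b; rewrite e21 mul1r o2o.
  constructor 3; split=> //; split=> // tri'.
  have [p p0 vp] := val_normalized o'.
  by have := moE p; rewrite tri' vp.
Qed.

Lemma generated_sub_multiple (A : valuation D -> int) (At : valuation Dt -> int) :
  divisor_extension j A At ->
  generated_ideal j (multiple_ideal i i' o o' A) (integral_ring it it' o ot')
  `<=` multiple_ideal it it' o ot' At.
Proof.
move=> hAt b [n [a [r [aI [rJ ->]]]]] mt tmt; have pm := valuation_preval mt.
have [m [e [me tm]]] := controlled_restrict tmt.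
rewrite (hAt _ _ _ me); apply: (vge_sum pm) => l _.
rewrite -[X in vge _ _ X]addr0; apply: (vgeM pm); last exact: rJ.
case: me => e0 me; case: (aI l m tm) => [->|h]; first by left; rewrite rmorph0.
by right; rewrite me ler_pM2l.
Qed.

Lemma lift_binary m mt e : binary i i' m -> lies_above j m mt e -> binary it it' mt.
Proof.
move=> [tr tr'] [e0 me]; split=> [a|]; first by rewrite hit me tr mulr0.
by apply: trivial_ext => b; rewrite [X in mt X]hit' me tr' mulr0.
Qed.

(** By composite_unramified with Kt' in the role of the trivially valued field. *)
Lemma lift_unary m mt e : unary_at i i' o m -> lies_above j m mt e ->
  unary_at it it' o mt.
Proof.
move=> [[tr' ntr] at_o] [e0 me].
have tr't : forall b, mt (it' b) = 0.
  by apply: trivial_ext => b; rewrite [X in mt X]hit' me tr' mulr0.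
have E a : mt (it a) = e%:Z * o a by rewrite hit me at_o.
have [icc _ gen] := hDt.
have e1 : e = 1%N.
  apply: (@composite_unramified _ _ _ _ (in_alg Kt' \o ff_const K') (ff_const K)
    (ff_var K) it' it char_k _ _ (function_field_generator (K := K)) mt o) => //.
  by move=> S cS h1 h2; apply: gen.
have moE a : mt (it a) = o a by rewrite E e1 mul1r.
split=> //; split=> // tri; have [p p0 vp] := val_normalized o.
by have := moE p; rewrite tri vp.
Qed.

(** The ramification index e over D equals that of the restriction to Kt' over
    o', since Dt is unramified over Kt'. *)
Lemma lift_unary' m mt e : unary_at' i i' o' m -> lies_above j m mt e ->
  exists o2, [/\ lies_above (in_alg Kt') o' o2 e,
    forall b, mt (it' b) = o2 b & unary_at' it it' o2 mt].
Proof.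
move=> [[tr ntr'] at_o'] [e0 me].
have trt a : mt (it a) = 0 by rewrite hit me tr mulr0.
have E b : mt (it' (in_alg Kt' b)) = e%:Z * o' b by rewrite hit' me at_o'.
have [p p0 vp] := val_normalized o'.
have [||e2 [o2 [e20 o2E]]] := @preval_normalize _ (mt \o it').
- exact/preval_comp/valuation_preval.
- by exists (in_alg Kt' p); rewrite [X in X != _]E vp mulr1; lia.
have o2t a : o2 (in_alg Kt' (ff_const K' a)) = 0.
  have := o2E (in_alg Kt' (ff_const K' a)); rewrite [X in X = _]E ho' mulr0 => /esym/eqP.
  by rewrite mulf_eq0 => /orP[/eqP|/eqP]; [lia|].
have [icc _ gen] := hDt.
have e21 : e2 = 1%N.
  by apply: (@composite_unramified _ _ _ _ (ff_const K) (in_alg Kt' \o ff_const K')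
    (in_alg Kt' (ff_var K')) it it' char_k icc gen generator_Kt' mt o2).
have o2E' b : mt (it' b) = o2 b by have := o2E b; rewrite e21 mul1r.
exists o2; split=> //; first by split=> // b; rewrite -o2E' E.
split=> //; split=> // tri; have := E p; rewrite tri vp; lia.
Qed.

(** Over o' the element b is uniformly bounded even at the places above the
    primes of Kt' other than ot', where its membership in the multiple ideal says
    nothing. The reason is that Dt is algebraic over K(t), with t of o'-value 1,
    and these places are trivial on K. *)
Lemma bounded_unary' (b : Dt) : exists C : nat, forall m mt e,
  unary_at' i i' o' m -> lies_above j m mt e -> vge mt b (- (C%:Z * e%:Z)).
Proof.
have [t t0 vt] := val_normalized o'.
pose tt := it' (in_alg Kt' t).
have [E [e1 [cI tI e1E]]] := simple_subfield it tt.
have [icc _ gen] := hDt.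
have trans (p : {poly k}) : p != 0 ->
    (map_poly (in_alg Kt' \o ff_const K') p).[in_alg Kt' t] != 0.
  move=> p0; apply/negP => pt; have [eo [eo0 oE]] := hot'.
  have : ot' (in_alg Kt' t) = 0.
    apply: (pval_algebraic0 (valuation_preval ot') (e := in_alg Kt' \o ff_const K')).
      exact: (above_trivial hot').
    by exists p.
  by rewrite oE vt; lia.
have gent := algebraic_generator_exchange generator_Kt' trans.
have alg z : algebraicOver e1 z.
  pose S : {pred Dt} := fun z => `[< algebraicOver e1 z >].
  suff : z \in S by move/asboolP.
  apply: gen.
  - split; first by apply/asboolP; apply: algebraic1.
      by move=> u w /asboolP hu /asboolP hw; apply/asboolP; apply: algebraic_sub.
    by move=> u w /asboolP hu /asboolP hw; apply/asboolP; apply: algebraic_div.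
  - by move=> a; apply/asboolP/algebraic_image.
  - move=> a; apply/asboolP; apply: (algebraic_generator_image gent).
      by move=> a1; rewrite -icc; apply: algebraic_image.
    exact: algebraic_image.
have [C CP] := bounded_poles e1E tI (alg b).
exists C => m mt e [[tr ntr'] at_o'] [e0 me].
have tte : mt tt = e%:Z by rewrite /tt hit' me at_o' vt mulr1.
by rewrite -tte; apply: CP => [a|]; [rewrite hit me tr mulr0|rewrite tte; lia].
Qed.

Lemma divisor_bounded (A : divisor i i') : exists C : nat, forall m, A m <= C%:Z.
Proof.
have /finite_seqP[s sE] := divisor_finite A.
have [r rP] := seq_bound s A; exists r => m.
have [->//|Am] := eqVneq (A m) 0.
by apply: rP; have : [set` s] m by rewrite -sE.
Qed.

Lemma controlled_natr m n : controlled m -> (0 < n)%N -> m n%:R = 0.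
Proof.
move=> tm n0; case: tm => [[tr _]|[[tr' _] _]|[[tr _] _]].
- by rewrite -(rmorph_nat i) tr.
- by rewrite -(rmorph_nat i') tr'.
- by rewrite -(rmorph_nat i) tr.
Qed.

(** The formula of reconstruction for u b, divided by u: the traces of u b y_l
    lie in the ideal of A, and the quotients x_l / u are integral. *)
Lemma multiple_sub_generated (A : divisor i i') (At : divisor it it') :
  divisor_extension j A At ->
  multiple_ideal it it' o ot' At `<=`
  generated_ideal j (multiple_ideal i i' o o' A) (integral_ring it it' o ot').
Proof.
move=> hAt b bI.
have [cjK] := galois_data_exist Kt' char_K'.
have [cjD] := galois_data_exist Dt char_D.
have [e0 oe0] := hot'; have [e00 oE] := oe0.
have natr n : (0 < n)%N -> o' n%:R = 0.
  by move=> _; rewrite -(rmorph_nat (ff_const K')) ho'.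
have [x [y [xy exp x0 y0]]] := dual_basis cjK char_K' natr oe0.
have [c [c' [c0 c'0 rec]]] := @reconstruction _ _ cjK char_K' _ x y xy exp D Dt cjD i' it'
  hit' (fun S cS h1 h2 => (let: And3 _ _ g := hDt in g) S cS
    (fun a => eq_ind_r (fun z => z \in S) (h1 (i a)) (hit a)) h2).
have [Cb CbP] := bounded_unary' b.
have [CA CAP] := divisor_bounded A.
have [Cy CyP] := choice (fun l => above_bounded o' (y l)).
(* C outweighs, at the primes over o' other than ot', the poles of b and y_l
   and the multiplicities of A. *)
pose C := (Cb + CA + \max_l Cy l)%N.
have [u [u1 u0]] := above_idempotent o' ot' C.
have [un0 otu] := unit_near1 (valuation_preval ot') u1.
have cn (n : nat) : (0 < n)%N -> n%:R != 0 :> D.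
  by move=> n0; have /pcharf0P -> := char_D; rewrite -lt0n.
pose T l := cj_trace cjD (it' u * b * it' (y l)).
exists (\dim {:Kt'}), (fun l => c%:R / c'%:R * T l), (fun l => it' (x l / u)); split; last split.
- move=> l m tm; have pm := valuation_preval m.
  rewrite -[A m]add0r; apply: (vgeM pm).
    right; rewrite pvalM ?invr_eq0 ?cn // pvalV // !controlled_natr //.
  apply: trace_vge => mt e me; have pmt := valuation_preval mt.
  have [ee mE] := me.
  have yP z : vge mt (it' z) 0 -> vge mt b (e%:Z * A m) -> vge mt (it' (y l)) 0 ->
      vge mt (it' z * b * it' (y l)) (e%:Z * (A m - 1) + 1).
    move=> h1 h2 h3; apply: (@vge_le _ _ _ (0 + e%:Z * A m + 0)); first by nia.
    by apply: vgeM => //; apply: vgeM.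
  case: tm => [bm|um|um'].
  + have bmt := lift_binary bm me; have [_ tr'] := bmt.
    apply: yP; try by right; rewrite tr'.
    by rewrite -(hAt _ _ _ me); apply: bI; constructor 1.
  + have umt := lift_unary um me; have [[tr' _] _] := umt.
    apply: yP; try by right; rewrite tr'.
    by rewrite -(hAt _ _ _ me); apply: bI; constructor 2.
  + have [o2 [o2e o2E umt]] := lift_unary' um' me.
    have ltr z n : vge o2 z n -> vge mt (it' z) n.
      by case=> [->|h]; [left; rewrite rmorph0|right; rewrite o2E].
    have [E|ne] := eqVneq o2 ot'.
      rewrite E in o2e o2E umt ltr.
      have eE : e0 = e.
        have [t t0 vt] := val_normalized o'; have := oE t.
        by case: o2e => _ /(_ t) ->; rewrite vt !mulr1; lia.
      (* The pole of y_l has order less than e, hence is lost in the trace. *)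
      apply: (@vge_le _ _ _ (0 + e%:Z * A m + (1 - e0%:Z))); first by rewrite eE; nia.
      apply: vgeM => //; last exact: ltr.
      apply: vgeM => //; first by right; rewrite o2E otu.
      by rewrite -(hAt _ _ _ me); apply: bI; constructor 3.
    apply: (@vge_le _ _ _ (C%:Z * e%:Z + - (Cb%:Z * e%:Z) + - ((Cy l)%:Z * e%:Z))).
      have le : (Cy l <= \max_l Cy l)%N by apply: leq_bigmax.
      have := CAP m; rewrite /C; nia.
    apply: vgeM => //; last by apply: ltr; apply: CyP.
    apply: vgeM => //; first by apply: ltr; apply: u0.
    exact: (CbP m).
- move=> l mt tmt; case: tmt => [[_ tr']|[[tr' _] _]|[_ at_o']].
  + by right; rewrite tr'.
  + by right; rewrite tr'.
  + have [xl0|xl] := x0 l; first by left; rewrite xl0 mul0r rmorph0.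
    have [->|xn0] := eqVneq (x l) 0; first by left; rewrite mul0r rmorph0.
    right; rewrite at_o' (pvalM (valuation_preval ot')) ?invr_eq0 //.
    by rewrite (pvalV (valuation_preval ot')) otu subr0.
- have := rec (it' u * b) => R.
  have itu0 : it' u != 0 by rewrite fmorph_eq0.
  have jn (n : nat) : j n%:R = n%:R by rewrite rmorph_nat.
  have c'D : (c'%:R : Dt) != 0 by rewrite -jn fmorph_eq0 cn.
  transitivity (c'%:R^-1 * (it' u)^-1 * (c'%:R * (it' u * b))).
    by field; rewrite c'D itu0.
  rewrite R mulrA mulr_sumr; apply: eq_bigr => l _.
  rewrite -/(T l) (rmorphM j) (fmorph_div j) !(rmorph_nat j) fmorph_div -(mulr_algl (T l)).
  by rewrite -[(T l)%:A]/(j (T l)); field; rewrite c'D itu0.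
Qed.

End Main.

Unset Implicit Arguments.

Theorem theorem3p3
  (k : fieldExtType rat)
  (K K' : fieldExtType {fraction {poly k}})
  (D : fieldType) (i : {rmorphism K -> D}) (i' : {rmorphism K' -> D})
  (hD : is_double_field (ff_const K) (ff_var K) (ff_const K') (ff_var K') i i')
  (Kt' : fieldExtType K')
  (Dt : fieldExtType D) (it : {rmorphism K -> Dt}) (it' : {rmorphism Kt' -> Dt})
  (hDt : is_double_field (ff_const K) (ff_var K)
           (in_alg Kt' \o ff_const K') (in_alg Kt' (ff_var K')) it it')
  (hit : forall a : K, it a = in_alg Dt (i a))
  (hit' : forall b : K', it' (in_alg Kt' b) = in_alg Dt (i' b))
  (A : divisor i i') (At : divisor it it')
  (hAt : divisor_extension (in_alg Dt) A At)
  (o : valuation K) (ho : trivial_on (ff_const K) o)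
  (o' : valuation K') (ho' : trivial_on (ff_const K') o')
  (ot' : valuation Kt')
  (hot' : exists e : nat, lies_above (in_alg Kt') o' ot' e) :
  multiple_ideal it it' o ot' At =
  generated_ideal (in_alg Dt) (multiple_ideal i i' o o' A)
    (integral_ring it it' o ot').
Proof.
apply/seteqP; split.
- exact: (multiple_sub_generated hDt hit hit' ho ho' hot' hAt).
- exact: (generated_sub_multiple hD hit hit' ho' hot' hAt).
Qed.
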